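(* For every $\tau>1$ there is a constant $K_\tau$ such that for every $n\ge 2$ and every $n$-point $\tau$-HST metric $(X,d)$ there is a randomized online algorithm for MTS on $(X,d)$ that is $K_\tau\log n$-competitive.
   Context: A $\tau$-HST metric ($\tau>1$) is the metric on the leaf set $X$ of a finite rooted tree with positive edge weights, given by weighted shortest-path distance, such that for every edge $e$, the diameter of the subtree rooted at the lower endpoint of $e$ is at most $1/\tau$ times the weight of $e$. MTS: a fixed initial state $\rho_0\in X$; input a finite sequence of cost functions $c_t:X\to\mathbb R_+$; a randomized online algorithm chooses a random state $\rho_t$ whose law depends only on $c_1,\dots,c_t$, paying $\sum_t[c_t(\rho_t)+d(\rho_{t-1},\rho_t)]$. $\mathsf{cost}^*(\mathbf c)$ is the infimum of this cost over deterministic state sequences from $\rho_0$. The algorithm is $\alpha$-competitive if for every $\rho_0$ there is $\beta$ with $\mathbb E[\mathsf{cost}]\le\alpha\,\mathsf{cost}^*(\mathbf c)+\beta$ for all $\mathbf c$. *)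

(* Defs.v *)
From Stdlib Require Import Reals List Arith.
Import ListNotations.
Open Scope R_scope.

(* A finite rooted tree; each child is given with the weight of the edge
   from the current node to it. Leaves are nodes without children. *)
Inductive tree : Type := Node : list (R * tree) -> tree.

(* A leaf is identified by its root-to-leaf path: the list of
   (child index, edge weight) pairs along the path. *)
Definition path := list (nat * R).

Fixpoint leaves (t : tree) : list path :=
  match t with
  | Node cs =>
      match cs with
      | [] => [ [] ]
      | _ =>
        (fix go (i : nat) (l : list (R * tree)) : list path :=
           match l with
           | [] => []
           | (w, c) :: r => map (cons (i, w)) (leaves c) ++ go (S i) r
           end) 0%nat cs
      end
  end.

Fixpoint pathw (p : path) : R :=
  match p with [] => 0 | (_, w) :: p' => w + pathw p' end.

Fixpoint pdist (p q : path) : R :=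
  match p, q with
  | (i, _) :: p', (j, _) :: q' =>
      if Nat.eqb i j then pdist p' q' else pathw p + pathw q
  | _, _ => pathw p + pathw q
  end.

Fixpoint is_HST (tau : R) (t : tree) : Prop :=
  match t with
  | Node cs =>
    (fix go (l : list (R * tree)) : Prop :=
       match l with
       | [] => True
       | (w, c) :: r =>
           0 < w /\
           (forall p q, In p (leaves c) -> In q (leaves c) -> pdist p q <= w / tau) /\
           is_HST tau c /\ go r
       end) cs
  end.

Definition npoints (t : tree) : nat := length (leaves t).
Definition tree_dist (t : tree) (i j : nat) : R :=
  pdist (nth i (leaves t) []) (nth j (leaves t) []).

Definition sumX (n : nat) (f : nat -> R) : R :=
  fold_right (fun i s => f i + s) 0 (seq 0 n).

Definition minX (n : nat) (f : nat -> R) : R :=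
  fold_right (fun i m => Rmin (f i) m) (f 0%nat) (seq 1 (n - 1)).

(* A randomized online algorithm, in behavioural form: given the cost
   functions c_1..c_t revealed so far and the past states rho_0..rho_{t-1},
   the probability of moving to state x at time t. *)
Definition ralg := list (nat -> R) -> list nat -> nat -> R.

Definition valid_ralg (n : nat) (A : ralg) : Prop :=
  (forall cs hs x, 0 <= A cs hs x) /\
  (forall cs hs, sumX n (fun x => A cs hs x) = 1).

Fixpoint exp_cost_aux (n : nat) (d : nat -> nat -> R) (A : ralg)
   (past : list (nat -> R)) (hist : list nat) (last : nat)
   (cs : list (nat -> R)) : R :=
  match cs with
  | [] => 0
  | c :: r =>
      sumX n (fun x => A (past ++ [c]) hist x *
                 (c x + d last x + exp_cost_aux n d A (past ++ [c]) (hist ++ [x]) x r))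
  end.

Definition exp_cost n d A (rho0 : nat) cs := exp_cost_aux n d A [] [rho0] rho0 cs.

Fixpoint opt_cost (n : nat) (d : nat -> nat -> R) (rho : nat)
   (cs : list (nat -> R)) : R :=
  match cs with
  | [] => 0
  | c :: r => minX n (fun x => c x + d rho x + opt_cost n d x r)
  end.

Definition nonneg_costs (n : nat) (cs : list (nat -> R)) : Prop :=
  forall c, In c cs -> forall x, (x < n)%nat -> 0 <= c x.

Definition competitive (n : nat) (d : nat -> nat -> R) (A : ralg) (alpha : R) : Prop :=
  forall rho0, (rho0 < n)%nat ->
    exists beta, forall cs, nonneg_costs n cs ->
      exp_cost n d A rho0 cs <= alpha * opt_cost n d rho0 cs + beta.

(* Main.v *)
Require Import Defs.
From Stdlib Require Import Reals List Arith.
From Stdlib Require Import Lra Lia Psatz FinFun Classical IndefiniteDescription.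
Import ListNotations.
Open Scope R_scope.

(** Up to a factor 4, a tree metric of this kind is an ultrametric, so X splits into blocks of half
the diameter Delta whose mutual distances lie between Delta/2 and Delta. Set r(m) = 4 + 4 ln m and
suppose that on each block, of size n_i, a fractional algorithm is r(n_i)-competitive with respect
to a potential of size O(r(n_i) Delta / 2). Its cost a_i on block i is fed to an algorithm
distributing mass over the blocks, which has to be competitive in the unfair sense that the offline
player at j pays r(n)/r(n_j) a_j. That algorithm is mirror descent with the regularizer
sum_i kappa_i (p_i + delta_i) ln (p_i + delta_i), where for all blocks but the largest one h,
kappa_i = r(n) / ln (n/n_i) and delta_i is a multiple of (n_i/n)^2. The excess r(n) - r(n_i) =
4 ln (n/n_i) of the ratio pays for the mass leaving a block i other than h in proportion to p_i. The
part of the movement proportional to delta_i is paid by the potential sum_i delta_i ln (p_i +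
delta_i), which only the normalization multiplier lambda can refill, and lambda is bounded in terms of the
cost that the algorithm pays. Moves in and out of h are seen at the other blocks, up to the change of
their total mass. The potentials stay O(r Delta) because the diameters decrease geometrically. *)

(** * Finite sums *)

Definition lsum (l : list nat) (f : nat -> R) : R :=
  fold_right (fun i s => f i + s) 0 l.

Lemma lsum_cons a l f : lsum (a :: l) f = f a + lsum l f.
Proof. reflexivity. Qed.

Lemma lsum_ext l f g : (forall i, In i l -> f i = g i) -> lsum l f = lsum l g.
Proof.
  induction l as [|a l IH]; intros H; [reflexivity|].
  rewrite !lsum_cons, (H a (or_introl eq_refl)), IH; [reflexivity|].
  intros i Hi; apply H; now right.
Qed.

Lemma lsum_le l f g : (forall i, In i l -> f i <= g i) -> lsum l f <= lsum l g.
Proof.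
  induction l as [|a l IH]; intros H; [apply Rle_refl|].
  rewrite !lsum_cons. apply Rplus_le_compat.
  - apply H; now left.
  - apply IH; intros i Hi; apply H; now right.
Qed.

Lemma lsum_plus l f g : lsum l (fun i => f i + g i) = lsum l f + lsum l g.
Proof. induction l as [|a l IH]; [simpl; lra|]. rewrite !lsum_cons, IH; lra. Qed.

Lemma lsum_minus l f g : lsum l (fun i => f i - g i) = lsum l f - lsum l g.
Proof. induction l as [|a l IH]; [simpl; lra|]. rewrite !lsum_cons, IH; lra. Qed.

Lemma lsum_scal l c f : lsum l (fun i => c * f i) = c * lsum l f.
Proof. induction l as [|a l IH]; [simpl; lra|]. rewrite !lsum_cons, IH; lra. Qed.

Lemma lsum_scal_r l c f : lsum l (fun i => f i * c) = lsum l f * c.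
Proof. induction l as [|a l IH]; [simpl; lra|]. rewrite !lsum_cons, IH; lra. Qed.

Lemma lsum_zero l : lsum l (fun _ => 0) = 0.
Proof. induction l as [|a l IH]; [reflexivity|]. rewrite lsum_cons, IH; lra. Qed.

Lemma lsum_eq0 l f : (forall i, In i l -> f i = 0) -> lsum l f = 0.
Proof. intros H. rewrite (lsum_ext l f (fun _ => 0) H). apply lsum_zero. Qed.

Lemma lsum_nonneg l f : (forall i, In i l -> 0 <= f i) -> 0 <= lsum l f.
Proof. intros H. rewrite <- (lsum_zero l). now apply lsum_le. Qed.

Lemma lsum_swap l m f :
  lsum l (fun i => lsum m (fun j => f i j)) = lsum m (fun j => lsum l (fun i => f i j)).
Proof.
  induction l as [|a l IH].
  - simpl. now rewrite lsum_zero.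
  - rewrite lsum_cons, IH, <- lsum_plus. reflexivity.
Qed.

Lemma lsum_term_le l f i :
  (forall j, In j l -> 0 <= f j) -> In i l -> f i <= lsum l f.
Proof.
  induction l as [|a l IH]; intros H Hi; [destruct Hi|].
  rewrite lsum_cons. destruct Hi as [->|Hi].
  - assert (0 <= lsum l f) by (apply lsum_nonneg; intros j Hj; apply H; now right). lra.
  - assert (f i <= lsum l f) by (apply IH; [intros j Hj; apply H; now right|assumption]).
    assert (0 <= f a) by (apply H; now left). lra.
Qed.

Lemma lsum_remove l h f :
  NoDup l -> In h l -> lsum l f = f h + lsum (remove Nat.eq_dec h l) f.
Proof.
  induction l as [|a l IH]; intros Hn Hi; [destruct Hi|].
  inversion Hn as [|? ? Ha Hl]; subst. simpl remove. destruct (Nat.eq_dec h a) as [->|Hne].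
  - rewrite notin_remove by assumption. reflexivity.
  - destruct Hi as [->|Hi]; [congruence|]. rewrite !lsum_cons, (IH Hl Hi). lra.
Qed.

Lemma lsum_indicator l k f :
  NoDup l -> In k l -> lsum l (fun i => if Nat.eqb k i then f i else 0) = f k.
Proof.
  intros Hn Hi. rewrite (lsum_remove l k _ Hn Hi), Nat.eqb_refl.
  rewrite lsum_eq0; [lra|]. intros i Hr. apply in_remove in Hr.
  destruct (Nat.eqb_spec k i); [|reflexivity]. intuition congruence.
Qed.

Lemma lsum_filter l (P : nat -> bool) f :
  lsum (filter P l) f = lsum l (fun i => if P i then f i else 0).
Proof.
  induction l as [|a l IH]; [reflexivity|]. simpl filter. rewrite lsum_cons, <- IH.
  destruct (P a); [reflexivity|lra].
Qed.

Lemma lsum_partition X I (rep : nat -> nat) f :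
  NoDup I -> (forall z, In z X -> In (rep z) I) ->
  lsum X f = lsum I (fun k => lsum (filter (fun z => Nat.eqb (rep z) k) X) f).
Proof.
  intros HI Hr.
  rewrite (lsum_ext I _ (fun k => lsum X (fun z => if Nat.eqb (rep z) k then f z else 0)))
    by (intros; apply lsum_filter).
  rewrite lsum_swap. apply lsum_ext. intros z Hz.
  symmetry. apply (lsum_indicator I (rep z) (fun _ => f z)); auto.
Qed.

Lemma exists_min {A : Type} (l : list A) (f : A -> R) :
  l <> [] -> exists x, In x l /\ forall y, In y l -> f x <= f y.
Proof.
  induction l as [|a l IH]; [congruence|]. intros _. destruct l as [|a' l].
  - exists a. split; [now left|]. intros y [->|[]]. apply Rle_refl.
  - destruct IH as [x [Hx Hm]]; [congruence|]. destruct (Rle_dec (f x) (f a)).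
    + exists x. split; [now right|]. intros y [<-|Hy]; auto.
    + exists a. split; [now left|]. intros y [<-|Hy]; [apply Rle_refl|].
      generalize (Hm y Hy). lra.
Qed.

(** * Elementary inequalities *)

Lemma ln_le_sub1 x : 0 < x -> ln x <= x - 1.
Proof.
  intros Hx. destruct (Req_dec (ln x) 0) as [H|H].
  - assert (x = 1) by (rewrite <- (exp_ln x Hx), H; apply exp_0). lra.
  - generalize (exp_ineq1 (ln x) H). rewrite (exp_ln x Hx). lra.
Qed.

Lemma ln_ge_1_sub_inv x : 0 < x -> 1 - / x <= ln x.
Proof.
  intros Hx. generalize (ln_le_sub1 (/ x) (Rinv_0_lt_compat x Hx)).
  rewrite ln_Rinv by assumption. lra.
Qed.


Lemma ln2_bounds : 1 / 2 <= ln 2 <= 1.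
Proof.
  split.
  - assert (H := ln_lt_2). lra.
  - assert (H := ln_le_sub1 2 ltac:(lra)). lra.
Qed.

Lemma Rdiv_nonneg a b : 0 <= a -> 0 < b -> 0 <= a / b.
Proof. intros. apply Rmult_le_pos; [assumption|]. left; now apply Rinv_0_lt_compat. Qed.

Lemma ln_mono x y : 0 < x -> x <= y -> ln x <= ln y.
Proof.
  intros Hx [H| ->]; [left; now apply ln_increasing|apply Rle_refl].
Qed.

Lemma exp_mono x y : x <= y -> exp x <= exp y.
Proof.
  intros [H| ->]; [left; now apply exp_increasing|apply Rle_refl].
Qed.

(** * Positive parts, total variation and probability vectors *)

Definition pos (x : R) : R := Rmax 0 x.

Lemma pos_nonneg x : 0 <= pos x.
Proof. apply Rmax_l. Qed.

Lemma pos_ge x : x <= pos x.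
Proof. apply Rmax_r. Qed.

Lemma pos_of_nonneg x : 0 <= x -> pos x = x.
Proof. apply Rmax_right. Qed.

Lemma pos_of_nonpos x : x <= 0 -> pos x = 0.
Proof. apply Rmax_left. Qed.

Lemma pos_sub x : pos x - pos (- x) = x.
Proof.
  destruct (Rle_dec 0 x).
  - rewrite pos_of_nonneg, (pos_of_nonpos (- x)); lra.
  - rewrite pos_of_nonpos, (pos_of_nonneg (- x)); lra.
Qed.

Lemma pos_minus x y : pos (x - y) - pos (y - x) = x - y.
Proof. generalize (pos_sub (x - y)). now replace (- (x - y)) with (y - x) by ring. Qed.

(** Only the outflow is summed; for vectors of equal mass this is half the l1 distance. *)
Definition tv (l : list nat) (p p' : nat -> R) : R := lsum l (fun i => pos (p i - p' i)).

Definition dist (l : list nat) (p : nat -> R) : Prop :=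
  (forall i, In i l -> 0 <= p i) /\ lsum l p = 1.

Lemma dist_le1 l p i : dist l p -> In i l -> p i <= 1.
Proof. intros [H0 H1] Hi. rewrite <- H1. now apply lsum_term_le. Qed.

Lemma tv_sym l p p' : lsum l p = lsum l p' -> tv l p p' = tv l p' p.
Proof.
  intros H. unfold tv.
  assert (E : lsum l (fun i => pos (p i - p' i)) - lsum l (fun i => pos (p' i - p i)) = 0).
  { rewrite <- lsum_minus, (lsum_ext l _ (fun i => p i - p' i))
      by (intros; apply pos_minus).
    rewrite lsum_minus. lra. }
  lra.
Qed.

(** * One mirror descent step on a weighted star *)

Section Step.

Variables (h : nat) (J : list nat) (kap del : nat -> R) (kmax s : R).
Let l := h :: J.

Hypothesis del_pos : forall i, In i l -> 0 < del i.
Hypothesis del_h : del h = 1.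
Hypothesis kap_pos : forall i, In i l -> 0 < kap i.
Hypothesis kap_max : forall i, In i l -> kap i <= kmax.
Hypothesis s_range : 0 <= s <= 1 / 8.
Hypothesis del_small : 2 * lsum J (fun i => del i * ln ((1 + del i) / del i)) <= s.
Hypothesis del_small' : 2 * kmax * lsum J (fun i => del i / kap i) <= s.

Variables (p p' b : nat -> R) (lam : R).
Hypothesis dist_p : dist l p.
Hypothesis dist_p' : dist l p'.
Hypothesis lam_nonneg : 0 <= lam.
Hypothesis b_nonneg : forall i, In i l -> 0 <= b i.

Let lr i := ln (p' i + del i) - ln (p i + del i).
(** [kap i] times the generalized Kullback-Leibler divergence of [p' i + del i] from [p i + del i]:
    the Bregman term that mirror descent gains in each step. *)
Let slack i := kap i * ((p' i + del i) * lr i - (p' i - p i)).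

(** Optimality conditions of the mirror step: [lam] is the multiplier of the normalization, and
    equality can fail only where the constraint [0 <= p' i] binds. *)
Hypothesis kkt_ge : forall i, In i l -> lam - b i <= kap i * lr i.
Hypothesis kkt_eq : forall i, In i l -> 0 < p' i -> kap i * lr i = lam - b i.

Let p_nonneg i : In i l -> 0 <= p i := proj1 dist_p i.
Let p'_nonneg i : In i l -> 0 <= p' i := proj1 dist_p' i.

(** [ln x <= x - 1] at the ratio of the shifted masses; [lr_ge] takes the inverse ratio. *)
Lemma lr_le i : In i l -> (p i + del i) * lr i <= p' i - p i.
Proof.
  intros Hi. assert (H1 := del_pos i Hi). assert (H2 := p_nonneg i Hi).
  assert (H3 := p'_nonneg i Hi).
  assert (E : lr i = ln ((p' i + del i) / (p i + del i))).
  { unfold lr, Rdiv. rewrite ln_mult, ln_Rinv; try lra. apply Rinv_0_lt_compat; lra. }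
  assert (Hp : 0 < (p' i + del i) / (p i + del i)) by (apply Rdiv_lt_0_compat; lra).
  generalize (ln_le_sub1 _ Hp). rewrite <- E. intros H.
  apply Rmult_le_compat_l with (r := p i + del i) in H; [|lra].
  replace ((p i + del i) * ((p' i + del i) / (p i + del i) - 1)) with (p' i - p i) in H
    by (field; lra).
  exact H.
Qed.

Lemma lr_ge i : In i l -> p' i - p i <= (p' i + del i) * lr i.
Proof.
  intros Hi. assert (H1 := del_pos i Hi). assert (H2 := p_nonneg i Hi).
  assert (H3 := p'_nonneg i Hi).
  assert (E : lr i = - ln ((p i + del i) / (p' i + del i))).
  { unfold lr, Rdiv. rewrite ln_mult, ln_Rinv; try lra. apply Rinv_0_lt_compat; lra. }
  assert (Hp : 0 < (p i + del i) / (p' i + del i)) by (apply Rdiv_lt_0_compat; lra).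
  generalize (ln_le_sub1 _ Hp). intros H.
  apply Rmult_le_compat_l with (r := p' i + del i) in H; [|lra].
  replace ((p' i + del i) * ((p i + del i) / (p' i + del i) - 1)) with (p i - p' i) in H
    by (field; lra).
  rewrite E. lra.
Qed.

Lemma slack_nonneg i : In i l -> 0 <= slack i.
Proof.
  intros Hi. unfold slack. apply Rmult_le_pos; [left; now apply kap_pos|].
  generalize (lr_ge i Hi). lra.
Qed.

(** Complementary slackness: either [kkt_eq] applies, or [p' i] is zero and both sides vanish. *)
Lemma p'_mul_lr i : In i l -> p' i * (kap i * lr i) = p' i * (lam - b i).
Proof.
  intros Hi. destruct (p'_nonneg i Hi) as [H|H].
  - now rewrite kkt_eq.
  - rewrite <- H. ring.
Qed.

(* The Bregman divergence [D_j] from the point mass at [j] has increment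
   [- kap j * lr j - sum_i kap i * del i * lr i + sum_i kap i * (p' i - p i)]. *)
Lemma bregman_step j : In j l ->
  - kap j * lr j - lsum l (fun i => kap i * del i * lr i) + lsum l (fun i => kap i * (p' i - p i))
  <= b j - lsum l (fun i => p' i * b i) - lsum l slack.
Proof.
  intros Hj.
  assert (E : lsum l slack = lsum l (fun i => p' i * lam) - lsum l (fun i => p' i * b i)
     + lsum l (fun i => kap i * del i * lr i) - lsum l (fun i => kap i * (p' i - p i))).
  { rewrite <- !lsum_minus, <- lsum_plus, <- lsum_minus. apply lsum_ext. intros i Hi.
    generalize (p'_mul_lr i Hi). unfold slack. lra. }
  rewrite lsum_scal_r, (proj2 dist_p') in E.
  generalize (kkt_ge j Hj). lra.
Qed.

(** [yu] and [xd] are the positive and negative parts of [del i * lr i]; [bk] and [sl] are the loss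
    paid and the divergence in units of [kap i]. *)
Let xd i := del i * pos (- lr i).
Let yu i := del i * pos (lr i).
Let bk i := p' i * b i / kap i.
Let sl i := slack i / kap i.

Lemma lr_sign i : In i l -> (p' i <= p i /\ lr i <= 0) \/ (p i < p' i /\ 0 <= lr i).
Proof.
  intros Hi. assert (H1 := del_pos i Hi). assert (H2 := p_nonneg i Hi).
  assert (H3 := p'_nonneg i Hi). unfold lr.
  destruct (Rle_lt_dec (p' i) (p i)) as [H|H]; [left|right]; split; try lra.
  - assert (ln (p' i + del i) <= ln (p i + del i)) by (apply ln_mono; lra). lra.
  - assert (ln (p i + del i) <= ln (p' i + del i)) by (apply ln_mono; lra). lra.
Qed.

Lemma bk_nonneg i : In i l -> 0 <= bk i.
Proof.
  intros Hi. unfold bk. apply Rdiv_nonneg; [|now apply kap_pos].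
  apply Rmult_le_pos; auto.
Qed.

Lemma sl_nonneg i : In i l -> 0 <= sl i.
Proof. intros Hi. apply Rdiv_nonneg; [now apply slack_nonneg|now apply kap_pos]. Qed.

Lemma xd_nonneg i : In i l -> 0 <= xd i.
Proof. intros Hi. apply Rmult_le_pos; [left; now apply del_pos|apply pos_nonneg]. Qed.

(** The lost mass is [sl i - (p' i + del i) * lr i]. Its [del i] part is [xd i]; its [p' i] part is
    at most [bk i] by complementary slackness, because [lam] is nonnegative. *)
Lemma down_le i : In i l -> pos (p i - p' i) <= xd i + bk i + sl i.
Proof.
  intros Hi. assert (Hk := kap_pos i Hi).
  assert (Hx := xd_nonneg i Hi). assert (Hb := bk_nonneg i Hi). assert (Hs := sl_nonneg i Hi).
  destruct (lr_sign i Hi) as [[H1 H2]|[H1 H2]].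
  - rewrite pos_of_nonneg by lra. unfold xd. rewrite pos_of_nonneg by lra.
    assert (E : p i - p' i = sl i - (p' i + del i) * lr i) by (unfold sl, slack; field; lra).
    assert (Hl : - (p' i * lr i) <= bk i).
    { apply Rmult_le_reg_l with (kap i); [assumption|].
      replace (kap i * bk i) with (p' i * b i) by (unfold bk; field; lra).
      generalize (p'_mul_lr i Hi) (Rmult_le_pos _ _ (p'_nonneg i Hi) lam_nonneg). lra. }
    lra.
  - rewrite pos_of_nonpos by lra. lra.
Qed.

Lemma yu_le_up i : In i l -> yu i <= pos (p' i - p i).
Proof.
  intros Hi. unfold yu. destruct (lr_sign i Hi) as [[H1 H2]|[H1 H2]].
  - rewrite (pos_of_nonpos (lr i)) by lra. generalize (pos_nonneg (p' i - p i)). lra.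
  - rewrite !pos_of_nonneg by lra. generalize (lr_le i Hi).
    generalize (Rmult_le_pos _ _ (p_nonneg i Hi) H2). lra.
Qed.

Let T := tv l p p'.

Lemma T_up : T = lsum l (fun i => pos (p' i - p i)).
Proof. apply tv_sym. now rewrite (proj2 dist_p), (proj2 dist_p'). Qed.

Lemma T_le : T <= lsum l xd + lsum l bk + lsum l sl.
Proof. unfold T, tv. rewrite <- !lsum_plus. apply lsum_le. exact down_le. Qed.

(** At least half of the mass stays in place, and there the optimality conditions express [lam]
    through the loss and the log-ratio. A negative log-ratio only helps; a positive one costs at
    most [kap i] times the gained mass. *)
Lemma lam_le : T <= 1 / 2 -> lam <= 2 * kmax * (lsum l bk + T).
Proof.
  intros HT.
  assert (Hm : 0 < kmax).
  { apply Rlt_le_trans with (kap h); [apply kap_pos|apply kap_max]; now left. }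
  (* The summand is the minimum of [p i] and [p' i], so [1 - T] is the mass that stays. *)
  assert (Hc : lsum l (fun i => p i - pos (p i - p' i)) = 1 - T).
  { rewrite lsum_minus, (proj2 dist_p). reflexivity. }
  assert (Hi : lam * (1 - T) <= kmax * (lsum l bk + T)).
  { rewrite T_up at 2. rewrite <- Hc, <- lsum_scal, <- lsum_plus, <- lsum_scal.
    apply lsum_le. intros i Hi.
    assert (Hk := kap_pos i Hi). assert (Hb := bk_nonneg i Hi).
    assert (Hbk : kap i * bk i = p' i * b i) by (unfold bk; field; lra).
    apply Rle_trans with (kap i * (bk i + pos (p' i - p i))).
    2:{ apply Rmult_le_compat_r; [|now apply kap_max].
        generalize (pos_nonneg (p' i - p i)). lra. }
    destruct (lr_sign i Hi) as [[H1 H2]|[H1 H2]].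
    - rewrite pos_of_nonneg, (pos_of_nonpos (p' i - p i)) by lra.
      generalize (p'_mul_lr i Hi). intros E.
      assert (0 <= p' i * (kap i * - lr i)).
      { apply Rmult_le_pos; [auto|]. apply Rmult_le_pos; lra. }
      lra.
    - rewrite pos_of_nonpos, (pos_of_nonneg (p' i - p i)) by lra.
      assert (E := kkt_eq i Hi (Rle_lt_trans _ _ _ (p_nonneg i Hi) H1)).
      assert (Hl := lr_le i Hi).
      assert (Hd : 0 <= del i * lr i)
        by (apply Rmult_le_pos; [left; now apply del_pos|lra]).
      assert (Hpl : kap i * (p i * lr i) <= kap i * (p' i - p i))
        by (apply Rmult_le_compat_l; lra).
      assert (Hpb : p i * b i <= p' i * b i)
        by (apply Rmult_le_compat_r; [now apply b_nonneg|lra]).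
      assert (Hpe : p i * (kap i * lr i) = p i * (lam - b i)) by now rewrite E.
      lra. }
  assert (lam * (1 / 2) <= lam * (1 - T)) by (apply Rmult_le_compat_l; lra).
  lra.
Qed.

(** If [T] is at most 1/2, a positive log-ratio is at most [lam / kap i] and [lam_le] applies.
    Otherwise [s * T] is at least [s / 2], which dominates the largest total that [yu] can reach on
    [J]. *)
Lemma up_sum_le : lsum J yu <= s * (T + lsum l bk).
Proof.
  assert (HB : 0 <= lsum l bk) by (apply lsum_nonneg; exact bk_nonneg).
  assert (Hy : lsum J yu <= lsum J (fun i => del i * ln ((1 + del i) / del i))).
  { apply lsum_le. intros i Hi. apply (in_cons h) in Hi. assert (Hd := del_pos i Hi).
    apply Rmult_le_compat_l; [lra|].
    unfold Rdiv. rewrite ln_mult, ln_Rinv; try lra; [|now apply Rinv_0_lt_compat].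
    assert (Hp := p_nonneg i Hi). assert (Hp' := p'_nonneg i Hi).
    assert (Hp1 := dist_le1 l p' i dist_p' Hi).
    assert (ln (p' i + del i) <= ln (1 + del i)) by (apply ln_mono; lra).
    assert (ln (del i) <= ln (p i + del i)) by (apply ln_mono; lra).
    assert (ln (del i) <= ln (1 + del i)) by (apply ln_mono; lra).
    apply Rmax_lub; unfold lr; lra. }
  destruct (Rle_lt_dec T (1 / 2)) as [HT|HT].
  - assert (Hl := lam_le HT).
    assert (HyL : lsum J yu <= lam * lsum J (fun i => del i / kap i)).
    { rewrite <- lsum_scal. apply lsum_le. intros i Hi. apply (in_cons h) in Hi.
      assert (Hk := kap_pos i Hi). assert (Hd := del_pos i Hi). unfold yu.
      destruct (lr_sign i Hi) as [[H1 H2]|[H1 H2]].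
      - rewrite pos_of_nonpos by lra. rewrite Rmult_0_r.
        apply Rmult_le_pos; [lra|]. apply Rdiv_nonneg; lra.
      - rewrite pos_of_nonneg by lra.
        assert (E := kkt_eq i Hi (Rle_lt_trans _ _ _ (p_nonneg i Hi) H1)).
        assert (El : lr i <= lam / kap i).
        { apply Rmult_le_reg_l with (kap i); [assumption|]. rewrite E.
          replace (kap i * (lam / kap i)) with lam by (field; lra).
          generalize (b_nonneg i Hi). lra. }
        apply Rle_trans with (del i * (lam / kap i)); [apply Rmult_le_compat_l; lra|].
        right. field. lra. }
    assert (HS : 0 <= lsum J (fun i => del i / kap i)).
    { apply lsum_nonneg. intros i Hi. apply (in_cons h) in Hi.
      apply Rdiv_nonneg; [left; now apply del_pos|now apply kap_pos]. }
    apply Rmult_le_compat_r with (r := lsum J (fun i => del i / kap i)) in Hl; [|assumption].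
    assert (HT0 : 0 <= T) by (apply lsum_nonneg; intros; apply pos_nonneg).
    assert (Hs2 := del_small').
    apply Rmult_le_compat_r with (r := T + lsum l bk) in Hs2; [|lra].
    lra.
  - assert (s * (1 / 2) <= s * T) by (apply Rmult_le_compat_l; lra).
    assert (0 <= s * lsum l bk) by (apply Rmult_le_pos; lra).
    lra.
Qed.

(** If the mass at [h] rises, its gain is at most [T] and [xd h] vanishes, so only the terms [xd] of
    the light blocks remain in [T_le]. *)
Lemma yu_h_le : yu h <= lsum J xd + lsum l bk + lsum l sl.
Proof.
  assert (Hh : In h l) by now left.
  assert (HX : 0 <= lsum J xd) by (apply lsum_nonneg; intros; apply xd_nonneg; now right).
  assert (HB : 0 <= lsum l bk) by (apply lsum_nonneg; exact bk_nonneg).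
  assert (HS : 0 <= lsum l sl) by (apply lsum_nonneg; exact sl_nonneg).
  destruct (lr_sign h Hh) as [[H1 H2]|[H1 H2]].
  - unfold yu. rewrite pos_of_nonpos by lra. lra.
  - apply Rle_trans with T.
    + rewrite T_up. apply Rle_trans with (pos (p' h - p h)); [now apply yu_le_up|].
      apply (lsum_term_le l (fun i => pos (p' i - p i)) h); [intros; apply pos_nonneg|assumption].
    + generalize T_le. unfold l at 1. rewrite lsum_cons. unfold xd at 1.
      rewrite pos_of_nonpos by lra. lra.
Qed.

(* The weight [2 * s] at [h] absorbs the part of the mass leaving [h] that is proportional to
   [del h = 1] and that [lam] passes on to the other blocks. *)
Lemma light_down_le :
  lsum J xd <= - 2 * (2 * s * lr h + lsum J (fun i => del i * lr i))
    + 8 * s * lsum l bk + 8 * s * lsum l sl.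
Proof.
  assert (Hh : In h l) by now left.
  assert (HX : 0 <= lsum J xd) by (apply lsum_nonneg; intros; apply xd_nonneg; now right).
  assert (HB : 0 <= lsum l bk) by (apply lsum_nonneg; exact bk_nonneg).
  assert (HS : 0 <= lsum l sl) by (apply lsum_nonneg; exact sl_nonneg).
  assert (Hxh := xd_nonneg h Hh).
  assert (EJ : lsum J (fun i => del i * lr i) = lsum J yu - lsum J xd).
  { rewrite <- lsum_minus. apply lsum_ext. intros i _. unfold yu, xd.
    rewrite <- Rmult_minus_distr_l, pos_sub. reflexivity. }
  assert (Eh : lr h = yu h - xd h).
  { unfold yu, xd. rewrite del_h, <- Rmult_minus_distr_l, pos_sub. ring. }
  assert (Hu := up_sum_le). assert (Hy := yu_h_le). assert (HT := T_le).
  unfold l at 1 in HT. rewrite lsum_cons in HT.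
  apply Rmult_le_compat_l with (r := s) in HT; [|lra].
  apply Rmult_le_compat_l with (r := 2 * s) in Hy; [|lra].
  assert (0 <= s * xd h) by (apply Rmult_le_pos; lra).
  assert (0 <= s * lsum l sl) by (apply Rmult_le_pos; lra).
  (* The bounds on [yu] bring back [6 * s * lsum J xd], which [s <= 1 / 8] absorbs. *)
  assert (0 <= (1 / 8 - s) * lsum J xd) by (apply Rmult_le_pos; lra).
  rewrite EJ, Eh. lra.
Qed.

(** Whichever way [h] moves, [T] is the gain or the loss over [J], hence at most their sum, which is
    twice the loss plus the change of mass on [J]. The terms in [lr] and the change of mass
    telescope in [star_potential]. *)
Lemma tv_step :
  T <= - 4 * (2 * s * lr h + lsum J (fun i => del i * lr i))
    + lsum J (fun i => p' i - p i)
    + 16 * s * bk h + 4 * lsum J bk + 4 * lsum l sl.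
Proof.
  assert (Hh : In h l) by now left.
  assert (HB : 0 <= lsum J bk) by (apply lsum_nonneg; intros; apply bk_nonneg; now right).
  assert (HS : 0 <= lsum l sl) by (apply lsum_nonneg; exact sl_nonneg).
  assert (HSh := sl_nonneg h Hh).
  assert (ES : lsum l sl = sl h + lsum J sl) by reflexivity.
  assert (EB : lsum l bk = bk h + lsum J bk) by reflexivity.
  set (dn := lsum J (fun i => pos (p i - p' i))).
  set (up := lsum J (fun i => pos (p' i - p i))).
  assert (Edu : up - dn = lsum J (fun i => p' i - p i)).
  { unfold up, dn. rewrite <- lsum_minus. apply lsum_ext. intros; apply pos_minus. }
  assert (Hdn0 : 0 <= dn) by (apply lsum_nonneg; intros; apply pos_nonneg).
  assert (Hup0 : 0 <= up) by (apply lsum_nonneg; intros; apply pos_nonneg).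
  assert (Hdn : dn <= lsum J xd + lsum J bk + lsum J sl).
  { unfold dn. rewrite <- !lsum_plus. apply lsum_le. intros; apply down_le; now right. }
  assert (HT : T <= dn + up).
  { destruct (Rle_lt_dec (p' h) (p h)).
    - rewrite T_up. unfold l. rewrite lsum_cons, pos_of_nonpos by lra. fold up. lra.
    - unfold T, tv, l. rewrite lsum_cons, pos_of_nonpos by lra. fold dn. lra. }
  assert (Hx := light_down_le).
  assert (0 <= (1 / 8 - s) * lsum J bk) by (apply Rmult_le_pos; lra).
  assert (0 <= (1 / 8 - s) * lsum l sl) by (apply Rmult_le_pos; lra).
  rewrite EB in Hx. lra.
Qed.

End Step.

(** * Existence of the mirror descent step *)

Lemma continuity_pt_lsum l (F : nat -> R -> R) x :
  (forall i, continuity_pt (F i) x) -> continuity_pt (fun y => lsum l (fun i => F i y)) x.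
Proof.
  intros H. induction l as [|a l IH].
  - apply continuity_pt_const. now intros ? ?.
  - apply (continuity_pt_plus (F a) (fun y => lsum l (fun i => F i y))); auto.
Qed.

Lemma pos_abs x : pos x = (x + Rabs x) / 2.
Proof.
  destruct (Rle_dec 0 x).
  - rewrite pos_of_nonneg, Rabs_right; lra.
  - rewrite pos_of_nonpos, Rabs_left; lra.
Qed.

Lemma continuity_pos f : continuity f -> continuity (fun y => pos (f y)).
Proof.
  intros H x.
  apply continuity_pt_locally_ext with (fun y => (f y + Rabs (f y)) * / 2) 1;
    [lra|intros y _; symmetry; apply pos_abs|].
  apply (continuity_pt_mult (fun y => f y + Rabs (f y)) (fun _ => / 2)).
  - apply (continuity_pt_plus f (fun y => Rabs (f y))); [apply H|].
    apply (continuity_pt_comp f Rabs); [apply H|apply Rcontinuity_abs].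
  - apply continuity_pt_const. now intros ? ?.
Qed.

(** For a trial multiplier [y] the optimality conditions suggest the truncated exponential update
    [F i y]. Its total mass is continuous in [y], at most 1 at 0 and at least 1 at [lsum l b], so
    some multiplier in between normalizes it. *)
Lemma mirror_step_exists l (kap del p b : nat -> R) :
  (forall i, In i l -> 0 < kap i) -> (forall i, In i l -> 0 < del i) ->
  dist l p -> (forall i, In i l -> 0 <= b i) ->
  exists p' lam, dist l p' /\ 0 <= lam /\
    (forall i, In i l -> lam - b i <= kap i * (ln (p' i + del i) - ln (p i + del i))) /\
    (forall i, In i l -> 0 < p' i ->
       kap i * (ln (p' i + del i) - ln (p i + del i)) = lam - b i).
Proof.
  intros Hk Hd [Hp0 Hp1] Hb.
  set (F := fun i y => pos ((p i + del i) * exp ((y - b i) * / kap i) - del i)).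
  set (f := fun y => lsum l (fun i => F i y) - 1).
  assert (Hf : continuity f).
  { intros x. apply (continuity_pt_minus (fun y => lsum l (fun i => F i y)) (fun _ => 1)).
    - apply continuity_pt_lsum. intros i. apply continuity_pos.
      intros y. apply (continuity_pt_minus (fun y => (p i + del i) * exp ((y - b i) * / kap i))
                         (fun _ => del i)).
      + apply (continuity_pt_mult (fun _ => p i + del i) (fun y => exp ((y - b i) * / kap i))).
        * apply continuity_pt_const. now intros ? ?.
        * apply (continuity_pt_comp (fun y => (y - b i) * / kap i) exp);
            [|apply derivable_continuous_pt, derivable_pt_exp].
          apply (continuity_pt_mult (fun y => y - b i) (fun _ => / kap i)).
          -- apply (continuity_pt_minus (fun y => y) (fun _ => b i)).
             ++ apply derivable_continuous_pt, derivable_pt_id.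
             ++ apply continuity_pt_const. now intros ? ?.
          -- apply continuity_pt_const. now intros ? ?.
      + apply continuity_pt_const. now intros ? ?.
    - apply continuity_pt_const. now intros ? ?. }
  assert (HB : 0 <= lsum l b) by now apply lsum_nonneg.
  assert (H0 : f 0 <= 0).
  { unfold f. rewrite <- Hp1. apply Rle_minus. apply lsum_le. intros i Hi. unfold F.
    apply Rmax_lub; [auto|].
    assert (exp ((0 - b i) * / kap i) <= 1).
    { rewrite <- exp_0. apply exp_mono. generalize (Hb i Hi) (Rinv_0_lt_compat _ (Hk i Hi)).
      intros; nra. }
    generalize (Hp0 i Hi) (Hd i Hi). intros; nra. }
  assert (H1 : 0 <= f (lsum l b)).
  { unfold f. rewrite <- Hp1. apply Rge_le, Rge_minus, Rle_ge. apply lsum_le. intros i Hi.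
    unfold F. eapply Rle_trans; [|apply pos_ge].
    assert (1 <= exp ((lsum l b - b i) * / kap i)).
    { rewrite <- exp_0. apply exp_mono.
      generalize (lsum_term_le l b i Hb Hi) (Rinv_0_lt_compat _ (Hk i Hi)). intros; nra. }
    generalize (Hp0 i Hi) (Hd i Hi). intros; nra. }
  destruct (IVT_cor f 0 (lsum l b) Hf HB) as [lam [[Hl _] El]]; [nra|].
  exists (fun i => F i lam), lam.
  assert (Eln : forall i, In i l -> ln ((p i + del i) * exp ((lam - b i) * / kap i)) =
                   ln (p i + del i) + (lam - b i) / kap i).
  { intros i Hi. rewrite ln_mult, ln_exp; [reflexivity| |apply exp_pos].
    generalize (Hp0 i Hi) (Hd i Hi). lra. }
  assert (Hq : forall i, In i l -> 0 < (p i + del i) * exp ((lam - b i) * / kap i)).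
  { intros i Hi. apply Rmult_lt_0_compat; [|apply exp_pos].
    generalize (Hp0 i Hi) (Hd i Hi). lra. }
  split; [split|split; [exact Hl|split]].
  - intros; apply pos_nonneg.
  - unfold f in El. lra.
  - intros i Hi. assert (Hki := Hk i Hi).
    assert (H : ln ((p i + del i) * exp ((lam - b i) * / kap i)) <= ln (F i lam + del i)).
    { apply ln_mono; [now apply Hq|]. unfold F.
      generalize (pos_ge ((p i + del i) * exp ((lam - b i) * / kap i) - del i)). lra. }
    rewrite Eln in H by assumption.
    apply Rle_trans with (kap i * ((lam - b i) / kap i)); [right; field; lra|].
    apply Rmult_le_compat_l; lra.
  - intros i Hi HF. assert (Hki := Hk i Hi).
    assert (E : F i lam + del i = (p i + del i) * exp ((lam - b i) * / kap i)).
    { unfold F in *. destruct (Rle_dec 0 ((p i + del i) * exp ((lam - b i) * / kap i) - del i)).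
      - rewrite pos_of_nonneg by assumption. ring.
      - rewrite pos_of_nonpos in HF by lra. lra. }
    rewrite E, Eln by assumption. field. lra.
Qed.

(** * Unfair metrical task systems on a uniform star *)

(** The slope 4 matches the factor 4 in front of [lsum J bk] in [tv_step]. *)
Definition ratio (x : R) : R := 4 + 4 * ln x.

Lemma ratio_ge4 x : 1 <= x -> 4 <= ratio x.
Proof. intros H. unfold ratio. generalize (ln_mono 1 x ltac:(lra) H). rewrite ln_1. lra. Qed.

(** The argument of the logarithm is at most [(1 + / x) ^ 2], whose logarithm is at most
    [2 * / x]. *)
Lemma sqr_mul_ln_le x : 0 < x -> x ^ 2 * ln ((1 + x ^ 2) / x ^ 2) <= 2 * x.
Proof.
  intros Hx. assert (Hi := Rinv_0_lt_compat x Hx).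
  assert (H : ln ((1 + x ^ 2) / x ^ 2) <= 2 * / x).
  { apply Rle_trans with (ln ((1 + / x) * (1 + / x))).
    - apply ln_mono; [apply Rdiv_lt_0_compat; nra|].
      replace ((1 + x ^ 2) / x ^ 2) with (1 + / x * / x) by (field; lra). nra.
    - rewrite ln_mult by lra. generalize (ln_le_sub1 (1 + / x) ltac:(lra)). lra. }
  apply Rle_trans with (x ^ 2 * (2 * / x)); [apply Rmult_le_compat_l; [nra|assumption]|].
  right. field. lra.
Qed.

Section Star.

Variables (h : nat) (J : list nat) (N : nat -> R).
Let l := h :: J.

Hypothesis h_notin : ~ In h J.
Hypothesis N_ge1 : forall i, In i l -> 1 <= N i.
Hypothesis N_max : forall i, In i J -> N i <= N h.

Let Nt := lsum l N.
Let r := ratio Nt.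
Let th i := N i / Nt.
Let sig := lsum J th.
(** The heavy block gets [ln 2] because [Nt / N h] may be close to 1; a light block has
    [2 * N i <= Nt], so [eta] is at least [ln 2] everywhere. *)
Let eta i := if Nat.eqb i h then ln 2 else ln (Nt / N i).
Let kap i := r / eta i.
(** One factor [th i] absorbs a logarithm and the other remains, so that the sums required to be
    small are multiples of [sig]. The divisor 32 fits [del_ln_sum] into [s]. *)
Let del i := if Nat.eqb i h then 1 else (th i / 32) ^ 2.
Let s := sig / 8.

(* The Bregman divergence from the point mass at [j], up to constants, plus the terms that pay for
   movement in [tv_step]; [6 * r] makes the sum nonnegative. *)
Definition star_potential (p : nat -> R) (j : nat) : R :=
  - kap j * ln (p j + del j) - lsum l (fun i => kap i * del i * ln (p i + del i))
  + lsum l (fun i => kap i * p i)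
  + 4 * (2 * s * ln (p h + del h) + lsum J (fun i => del i * ln (p i + del i)))
  - lsum J p + 6 * r.

Lemma light_neq i : In i J -> Nat.eqb i h = false.
Proof. intros Hi. destruct (Nat.eqb_spec i h); [subst; contradiction|reflexivity]. Qed.

Lemma N_le i : In i l -> N i <= Nt.
Proof. intros Hi. apply lsum_term_le; [|assumption]. intros j Hj. generalize (N_ge1 j Hj). lra. Qed.

Lemma Nt_ge1 : 1 <= Nt.
Proof.
  assert (Hh : In h l) by now left. generalize (N_ge1 h Hh) (N_le h Hh). lra.
Qed.

Lemma N_light i : In i J -> 2 * N i <= Nt.
Proof.
  intros Hi. assert (Hm := N_max i Hi). unfold Nt, l. rewrite lsum_cons.
  assert (N i <= lsum J N); [|lra].
  apply lsum_term_le; [|assumption]. intros j Hj. generalize (N_ge1 j (in_cons h j J Hj)). lra.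
Qed.

Lemma th_pos i : In i l -> 0 < th i <= 1.
Proof.
  intros Hi. assert (H1 := N_ge1 i Hi). assert (H2 := N_le i Hi). unfold th. split.
  - apply Rdiv_lt_0_compat; lra.
  - apply Rmult_le_reg_r with Nt; [lra|]. replace (N i / Nt * Nt) with (N i) by (field; lra). lra.
Qed.

Lemma sig_eq : sig = 1 - th h.
Proof.
  assert (H := Nt_ge1). unfold sig.
  rewrite (lsum_ext J th (fun i => / Nt * N i)) by (intros; unfold th; field; lra).
  rewrite lsum_scal. unfold th.
  replace (lsum J N) with (Nt - N h) by (unfold Nt, l; rewrite lsum_cons; ring).
  field. lra.
Qed.

Lemma sig_range : 0 <= sig <= 1.
Proof.
  split; [apply lsum_nonneg; intros i Hi; left; apply th_pos; now right|].
  rewrite sig_eq. generalize (th_pos h (or_introl eq_refl)). lra.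
Qed.

Lemma r_ge4 : 4 <= r.
Proof. apply ratio_ge4, Nt_ge1. Qed.

Lemma ln_Nt_div i : In i l -> ln (Nt / N i) = ln Nt - ln (N i).
Proof.
  intros Hi. assert (H1 := N_ge1 i Hi). assert (H2 := N_le i Hi).
  unfold Rdiv. rewrite ln_mult, ln_Rinv; try lra. apply Rinv_0_lt_compat; lra.
Qed.

Lemma eta_range i : In i l -> ln 2 <= eta i <= r / 4.
Proof.
  intros Hi. unfold eta. assert (H4 := r_ge4). assert (H2 := ln2_bounds).
  destruct Hi as [<-|Hi]; [rewrite Nat.eqb_refl; lra|].
  rewrite light_neq by assumption. assert (Hl := in_cons h i J Hi). split.
  - assert (H1 := N_ge1 i Hl). assert (H3 := N_light i Hi). apply ln_mono; [lra|].
    apply Rmult_le_reg_r with (N i); [lra|].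
    replace (Nt / N i * N i) with Nt by (field; lra). lra.
  - rewrite ln_Nt_div by assumption.
    assert (0 <= ln (N i)) by (rewrite <- ln_1; apply ln_mono; [lra|now apply N_ge1]).
    unfold r, ratio. lra.
Qed.

Lemma eta_pos i : In i l -> 0 < eta i.
Proof. intros Hi. generalize (eta_range i Hi) ln2_bounds. lra. Qed.

Lemma kap_eta i : In i l -> kap i * eta i = r.
Proof. intros Hi. unfold kap. field. generalize (eta_pos i Hi). lra. Qed.

Lemma kap_ge4 i : In i l -> 4 <= kap i.
Proof.
  intros Hi. assert (He := eta_range i Hi). assert (Hp := eta_pos i Hi).
  apply Rmult_le_reg_r with (eta i); [assumption|]. rewrite kap_eta by assumption. lra.
Qed.

Lemma kap_le i : In i l -> kap i <= r / ln 2.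
Proof.
  intros Hi. assert (He := eta_range i Hi). assert (H2 := ln2_bounds). assert (H4 := r_ge4).
  unfold kap, Rdiv. apply Rmult_le_compat_l; [lra|]. apply Rinv_le_contravar; lra.
Qed.

Lemma kmax_le : r / ln 2 <= 2 * r.
Proof.
  assert (H2 := ln2_bounds). assert (H4 := r_ge4).
  apply Rmult_le_reg_r with (ln 2); [lra|]. replace (r / ln 2 * ln 2) with r by (field; lra). nra.
Qed.

Lemma del_heavy : del h = 1.
Proof. unfold del. now rewrite Nat.eqb_refl. Qed.

Lemma del_light i : In i J -> del i = (th i / 32) ^ 2.
Proof. intros Hi. unfold del. now rewrite light_neq. Qed.

Lemma delta_pos i : In i l -> 0 < del i <= 1.
Proof.
  intros [<-|Hi]; [rewrite del_heavy; lra|].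
  rewrite del_light by assumption. generalize (th_pos i (in_cons h i J Hi)). nra.
Qed.

Lemma eta_light i : In i J -> eta i = - ln (th i).
Proof.
  intros Hi. unfold eta. rewrite light_neq by assumption. assert (Hl := in_cons h i J Hi).
  assert (H1 := N_ge1 i Hl). assert (H2 := N_le i Hl). rewrite ln_Nt_div by assumption.
  unfold th, Rdiv. rewrite ln_mult, ln_Rinv; try lra. apply Rinv_0_lt_compat; lra.
Qed.

Lemma del_ln_sum : lsum J (fun i => del i * ln ((1 + del i) / del i)) <= sig / 16.
Proof.
  unfold sig. replace (lsum J th / 16) with (/ 16 * lsum J th) by field.
  rewrite <- lsum_scal. apply lsum_le. intros i Hi. rewrite del_light by assumption.
  assert (Ht := th_pos i (in_cons h i J Hi)).
  generalize (sqr_mul_ln_le (th i / 32) ltac:(lra)). lra.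
Qed.

(** [r] cancels and leaves [th i * (th i * eta i)] up to constants, where [th i * eta i] is
    [- th i * ln (th i)] and hence at most 1. *)
Lemma del_kap_sum : 2 * (r / ln 2) * lsum J (fun i => del i / kap i) <= s.
Proof.
  unfold s, sig. replace (lsum J th / 8) with (/ 8 * lsum J th) by field.
  rewrite <- !lsum_scal. apply lsum_le. intros i Hi. rewrite del_light by assumption.
  assert (Hl := in_cons h i J Hi). assert (Ht := th_pos i Hl).
  assert (He := eta_pos i Hl). assert (H4 := r_ge4). assert (H2 := ln2_bounds).
  unfold kap.
  replace (2 * (r / ln 2) * ((th i / 32) ^ 2 / (r / eta i)))
    with (/ ln 2 * (th i * (th i * eta i)) / 512) by (field; lra).
  assert (Hte : th i * eta i <= 1).
  { rewrite eta_light by assumption.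
    generalize (ln_ge_1_sub_inv (th i) ltac:(lra)). intros H.
    apply Rmult_le_compat_l with (r := th i) in H; [|lra].
    replace (th i * (1 - / th i)) with (th i - 1) in H by (field; lra). lra. }
  assert (Hi2 : / ln 2 <= 2).
  { apply Rmult_le_reg_r with (ln 2); [lra|]. rewrite Rinv_l; lra. }
  assert (th i * (th i * eta i) <= th i * 1) by (apply Rmult_le_compat_l; lra).
  assert (0 <= th i * (th i * eta i)) by (apply Rmult_le_pos; [lra|apply Rmult_le_pos; lra]).
  assert (/ ln 2 * (th i * (th i * eta i)) <= 2 * (th i * (th i * eta i)))
    by (apply Rmult_le_compat_r; lra).
  lra.
Qed.

(** * Range of the star potential *)

Lemma ln_shift_range p i : dist l p -> In i l -> ln (del i) <= ln (p i + del i) <= 1.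
Proof.
  intros Hp Hi. assert (Hd := delta_pos i Hi). assert (H0 := proj1 Hp i Hi).
  assert (H1 := dist_le1 l p i Hp Hi). split; [apply ln_mono; lra|].
  apply Rle_trans with (ln 2); [apply ln_mono; lra|apply ln2_bounds].
Qed.

Lemma del_ln_light_range p i : dist l p -> In i J ->
  - (th i / 16) <= del i * ln (p i + del i) <= th i / 16.
Proof.
  intros Hp Hi. assert (Hl := in_cons h i J Hi). assert (Hr := ln_shift_range p i Hp Hl).
  assert (Hd := delta_pos i Hl). assert (Ht := th_pos i Hl).
  assert (H := sqr_mul_ln_le (th i / 32) ltac:(lra)). rewrite <- del_light in H by assumption.
  assert (E : ln ((1 + del i) / del i) = ln (1 + del i) - ln (del i)).
  { unfold Rdiv. rewrite ln_mult, ln_Rinv; try lra. apply Rinv_0_lt_compat; lra. }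
  assert (0 <= ln (1 + del i)) by (rewrite <- ln_1; apply ln_mono; lra).
  assert (del i <= th i / 16) by (rewrite del_light by assumption; nra).
  split; [|nra].
  assert (del i * - ln (p i + del i) <= del i * ln ((1 + del i) / del i))
    by (apply Rmult_le_compat_l; lra).
  lra.
Qed.

Lemma del_ln_light_sum p : dist l p ->
  - 1 <= lsum J (fun i => del i * ln (p i + del i)) <= 1.
Proof.
  intros Hp. assert (Hs := sig_range). unfold sig in Hs.
  assert (E : lsum J (fun i => th i / 16) = / 16 * lsum J th).
  { rewrite <- lsum_scal. apply lsum_ext. intros; field. }
  split.
  - apply Rle_trans with (lsum J (fun i => (-1) * (th i / 16))); [rewrite lsum_scal; lra|].
    apply lsum_le. intros i Hi. generalize (del_ln_light_range p i Hp Hi). lra.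
  - apply Rle_trans with (lsum J (fun i => th i / 16)); [|lra].
    apply lsum_le. intros i Hi. apply (del_ln_light_range p i Hp Hi).
Qed.

Lemma kap_del_ln_light_sum p : dist l p ->
  - (2 * r) <= lsum J (fun i => kap i * del i * ln (p i + del i)) <= 2 * r.
Proof.
  intros Hp. assert (Hs := sig_range). unfold sig in Hs. assert (Hr := r_ge4).
  assert (Hi : forall i, In i J ->
    - (2 * r * th i) <= kap i * del i * ln (p i + del i) <= 2 * r * th i).
  { intros i Hi. assert (Hl := in_cons h i J Hi). assert (Ht := th_pos i Hl).
    assert (Hk4 := kap_ge4 i Hl). assert (Hk := kap_le i Hl). assert (Hm := kmax_le).
    destruct (del_ln_light_range p i Hp Hi) as [H1 H2]. rewrite Rmult_assoc.
    assert (kap i * th i <= 2 * r * th i) by (apply Rmult_le_compat_r; lra).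
    split.
    - assert (kap i * - (th i / 16) <= kap i * (del i * ln (p i + del i)))
        by (apply Rmult_le_compat_l; lra). nra.
    - assert (kap i * (del i * ln (p i + del i)) <= kap i * (th i / 16))
        by (apply Rmult_le_compat_l; lra). nra. }
  split.
  - apply Rle_trans with (lsum J (fun i => - (2 * r) * th i)); [rewrite lsum_scal; nra|].
    apply lsum_le. intros i HJ. generalize (Hi i HJ). lra.
  - apply Rle_trans with (lsum J (fun i => 2 * r * th i)); [|rewrite lsum_scal; nra].
    apply lsum_le. intros i HJ. apply (Hi i HJ).
Qed.

(** Both bounds rest on [kap j * eta j = r]. At a light block [- ln (del j)] is
    [2 * eta j + 10 * ln 2], at most [12 * eta j]. *)
Lemma kap_ln_range p j : dist l p -> In j l -> - r <= - kap j * ln (p j + del j) <= 12 * r.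
Proof.
  intros Hp Hj. assert (Hr := r_ge4). assert (H2 := ln2_bounds).
  assert (Hk4 := kap_ge4 j Hj). assert (Hk := kap_le j Hj). assert (He := eta_range j Hj).
  assert (H0 := proj1 Hp j Hj). assert (H1 := dist_le1 l p j Hp Hj).
  assert (Hd := delta_pos j Hj). assert (Ek := kap_eta j Hj).
  split.
  - assert (ln (p j + del j) <= ln 2) by (apply ln_mono; lra).
    assert (kap j * ln (p j + del j) <= kap j * eta j) by (apply Rmult_le_compat_l; lra). lra.
  - assert (Hlow : - ln (p j + del j) <= 12 * eta j).
    { apply Rle_trans with (- ln (del j)); [generalize (ln_shift_range p j Hp Hj); lra|].
      destruct Hj as [<-|Hj]; [rewrite del_heavy, ln_1; lra|].
      rewrite del_light by assumption. assert (Ht := th_pos j (in_cons h j J Hj)).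
      rewrite eta_light in * by assumption.
      replace ((th j / 32) ^ 2) with ((th j * / 2 ^ 5) * (th j * / 2 ^ 5)) by field.
      assert (0 < 2 ^ 5) by lra. assert (0 < / 2 ^ 5) by (apply Rinv_0_lt_compat; lra).
      rewrite !ln_mult, ln_Rinv, ln_pow by nra.
      simpl INR. lra. }
    assert (kap j * - ln (p j + del j) <= kap j * (12 * eta j)) by (apply Rmult_le_compat_l; lra).
    lra.
Qed.

(** Without the shift the terms add up to something between [- 4 * r - 5] and [16 * r + 5]; as
    [r >= 4], the shift by [6 * r] brings this into the range. *)
Lemma star_potential_range p j : dist l p -> In j l -> 0 <= star_potential p j <= 24 * r.
Proof.
  intros Hp Hj. assert (Hr := r_ge4). assert (H2 := ln2_bounds).
  assert (Hh : In h l) by now left.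
  assert (A1 := kap_ln_range p j Hp Hj).
  assert (A2 := kap_del_ln_light_sum p Hp).
  assert (A3 := del_ln_light_sum p Hp).
  assert (A4 : 0 <= lsum l (fun i => kap i * p i) <= 2 * r).
  { split.
    - apply lsum_nonneg. intros i Hi. generalize (kap_ge4 i Hi) (proj1 Hp i Hi). intros; nra.
    - apply Rle_trans with (lsum l (fun i => 2 * r * p i)).
      + apply lsum_le. intros i Hi. apply Rmult_le_compat_r; [apply (proj1 Hp i Hi)|].
        generalize (kap_le i Hi) kmax_le. lra.
      + rewrite lsum_scal, (proj2 Hp). lra. }
  assert (A5 : 0 <= ln (p h + del h) <= ln 2).
  { rewrite del_heavy, <- ln_1. generalize (proj1 Hp h Hh) (dist_le1 l p h Hp Hh). intros.
    split; apply ln_mono; lra. }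
  assert (A6 : 0 <= kap h * ln (p h + del h) <= r).
  { generalize (kap_ge4 h Hh). intros. split; [apply Rmult_le_pos; lra|].
    rewrite <- (kap_eta h Hh). apply Rmult_le_compat_l; [lra|].
    generalize (eta_range h Hh). lra. }
  assert (A7 : 0 <= lsum J p <= 1).
  { split; [apply lsum_nonneg; intros i Hi; apply (proj1 Hp); now right|].
    generalize (proj2 Hp). unfold l. rewrite lsum_cons. generalize (proj1 Hp h Hh). lra. }
  assert (A8 : 0 <= s * ln (p h + del h) <= 1 / 8).
  { generalize sig_range. unfold s. intros. split; [apply Rmult_le_pos; lra|]. nra. }
  assert (E : lsum l (fun i => kap i * del i * ln (p i + del i)) =
     kap h * ln (p h + del h) + lsum J (fun i => kap i * del i * ln (p i + del i))).
  { unfold l. rewrite lsum_cons, del_heavy. ring. }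
  unfold star_potential. rewrite E. lra.
Qed.

(** Mirror descent runs on the inflated losses [b], the amounts charged to the offline player. The
    sum of [bregman_step] and [tv_step] telescopes into [star_potential]; [HS] pays the divergence
    terms, and [HA] pays the service cost and the loss terms of the movement out of the inflated
    loss. *)
Lemma star_step p a : dist l p -> (forall i, In i l -> 0 <= a i) ->
  exists p', dist l p' /\ forall j, In j l ->
    lsum l (fun i => p' i * a i) + tv l p p' + star_potential p' j - star_potential p j
    <= r / ratio (N j) * a j.
Proof.
  intros Hp Ha. assert (Hr := r_ge4). assert (Hsg := sig_range).
  set (b := fun i => r / ratio (N i) * a i).
  assert (Hri : forall i, In i l -> 4 <= ratio (N i)) by (intros; apply ratio_ge4; auto).
  assert (Hb : forall i, In i l -> 0 <= b i).
  { intros i Hi. apply Rmult_le_pos; [|auto]. generalize (Hri i Hi). intros.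
    apply Rdiv_nonneg; lra. }
  assert (Hkp : forall i, In i l -> 0 < kap i).
  { intros i Hi. generalize (kap_ge4 i Hi). lra. }
  assert (Hdp : forall i, In i l -> 0 < del i) by (intros; now apply delta_pos).
  destruct (mirror_step_exists l kap del p b Hkp Hdp Hp Hb) as (p' & lam & Hp' & Hl & K1 & K2).
  exists p'. split; [assumption|]. intros j Hj.
  assert (Hs : 0 <= s <= 1 / 8) by (unfold s; lra).
  assert (Hds : 2 * lsum J (fun i => del i * ln ((1 + del i) / del i)) <= s)
    by (generalize del_ln_sum; unfold s; lra).
  assert (HB := bregman_step h J kap del p p' b lam Hp' K1 K2 j Hj).
  assert (HT := tv_step h J kap del (r / ln 2) s Hdp del_heavy Hkp kap_le Hs Hds del_kap_sum
                  p p' b lam Hp Hp' Hl Hb K2).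
  cbv beta zeta in HB, HT. fold l in HB, HT.
  assert (HS : 4 * lsum l (fun i => kap i * ((p' i + del i) * (ln (p' i + del i) - ln (p i + del i))
                 - (p' i - p i)) / kap i)
     <= lsum l (fun i => kap i * ((p' i + del i) * (ln (p' i + del i) - ln (p i + del i))
                 - (p' i - p i)))).
  { rewrite <- lsum_scal. apply lsum_le. intros i Hi.
    assert (Hk := kap_ge4 i Hi).
    assert (H := lr_ge h J del Hdp p p' Hp Hp' i Hi).
    set (w := (p' i + del i) * (ln (p' i + del i) - ln (p i + del i)) - (p' i - p i)) in *.
    assert (0 <= w) by (unfold w; lra).
    replace (kap i * w / kap i) with w by (field; lra). nra. }
  assert (HA : lsum l (fun i => p' i * a i) + 16 * s * (p' h * b h / kap h)
      + 4 * lsum J (fun i => p' i * b i / kap i) <= lsum l (fun i => p' i * b i)).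
  { unfold l. rewrite !lsum_cons. rewrite <- lsum_scal.
    (* Termwise equality: [b i / kap i] is [eta i * a i / ratio (N i)], and
       [r = ratio (N i) + 4 * eta i]. *)
    assert (HJ : lsum J (fun i => p' i * a i) + lsum J (fun i => 4 * (p' i * b i / kap i))
               <= lsum J (fun i => p' i * b i)).
    { rewrite <- lsum_plus. apply lsum_le. intros i Hi. assert (Hil := in_cons h i J Hi).
      right. unfold b, kap. assert (He := eta_pos i Hil). assert (H4 := Hri i Hil).
      assert (E : r = ratio (N i) + 4 * eta i).
      { unfold eta. rewrite light_neq, ln_Nt_div by assumption. unfold r, ratio. ring. }
      transitivity (p' i * a i * (ratio (N i) + 4 * eta i) / ratio (N i)); [field; lra|].
      rewrite <- E. field; lra. }
    assert (Hh : In h l) by now left.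
    (* At [h] the excess [r - ratio (N h) = - 4 * ln (th h)] is at least [4 * sig], while the
       movement needs [16 * s * ln 2], at most [2 * sig]. *)
    assert (Hhv : p' h * a h + 16 * s * (p' h * b h / kap h) <= p' h * b h).
    { assert (H4 := Hri h Hh). assert (H2 := ln2_bounds). assert (Ht := th_pos h Hh).
      unfold b, kap, eta. rewrite Nat.eqb_refl.
      assert (E : r = ratio (N h) - 4 * ln (th h)).
      { replace (ln (th h)) with (- ln (Nt / N h)).
        - rewrite ln_Nt_div by assumption. unfold r, ratio. ring.
        - assert (H1 := N_ge1 h Hh). assert (H1' := Nt_ge1).
          rewrite <- ln_Rinv by (apply Rdiv_lt_0_compat; lra). f_equal. unfold th. field. lra. }
      assert (Hln := ln_le_sub1 (th h) ltac:(lra)). assert (Es := sig_eq).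
      replace (p' h * a h + 16 * s * (p' h * (r / ratio (N h) * a h) / (r / ln 2)))
        with ((ratio (N h) + 2 * sig * ln 2) * (p' h * a h / ratio (N h)))
        by (unfold s; field; lra).
      replace (p' h * (r / ratio (N h) * a h)) with (r * (p' h * a h / ratio (N h)))
        by (field; lra).
      apply Rmult_le_compat_r; [|nra].
      apply Rdiv_nonneg; [|lra]. apply Rmult_le_pos; [apply (proj1 Hp' h Hh)|auto]. }
    lra. }
  change (r / ratio (N j) * a j) with (b j).
  unfold star_potential.
  assert (E1 : lsum l (fun i => kap i * del i * (ln (p' i + del i) - ln (p i + del i))) =
    lsum l (fun i => kap i * del i * ln (p' i + del i))
    - lsum l (fun i => kap i * del i * ln (p i + del i))).
  { rewrite <- lsum_minus. apply lsum_ext. intros; ring. }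
  assert (E2 : lsum l (fun i => kap i * (p' i - p i)) =
    lsum l (fun i => kap i * p' i) - lsum l (fun i => kap i * p i)).
  { rewrite <- lsum_minus. apply lsum_ext. intros; ring. }
  assert (E3 : lsum J (fun i => del i * (ln (p' i + del i) - ln (p i + del i))) =
    lsum J (fun i => del i * ln (p' i + del i)) - lsum J (fun i => del i * ln (p i + del i))).
  { rewrite <- lsum_minus. apply lsum_ext. intros; ring. }
  rewrite E1, E2 in HB. rewrite E3, lsum_minus in HT. lra.
Qed.

End Star.

(** Hides the choice of the heavy block: a largest one, found as a minimizer of [- N i], is taken
    for [h]. *)
Lemma unfair_star (I : list nat) (N : nat -> R) :
  NoDup I -> I <> [] -> (forall i, In i I -> 1 <= N i) ->
  exists Psi : (nat -> R) -> nat -> R,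
    (forall p j, dist I p -> In j I -> 0 <= Psi p j <= 24 * ratio (lsum I N)) /\
    (forall p a, dist I p -> (forall i, In i I -> 0 <= a i) ->
       exists p', dist I p' /\ forall j, In j I ->
         lsum I (fun i => p' i * a i) + tv I p p' + Psi p' j - Psi p j
         <= ratio (lsum I N) / ratio (N j) * a j).
Proof.
  intros Hn He HN. destruct (exists_min I (fun i => - N i) He) as [h [Hh Hm]].
  set (J := remove Nat.eq_dec h I).
  assert (ES : forall f, lsum I f = lsum (h :: J) f) by (intros; now apply lsum_remove).
  assert (EI : forall i, In i I <-> In i (h :: J)).
  { intros i. split.
    - intros Hi. destruct (Nat.eq_dec h i) as [->|Hne]; [now left|right].
      apply in_in_remove; [congruence|assumption].
    - intros [<-|Hi]; [assumption|]. now apply in_remove in Hi. }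
  assert (ED : forall p, dist I p <-> dist (h :: J) p).
  { intros p. unfold dist. rewrite ES. split; intros [H0 H1]; split; auto; intros i Hi;
      apply H0, EI, Hi. }
  assert (HJ : ~ In h J) by apply remove_In.
  assert (HN' : forall i, In i (h :: J) -> 1 <= N i) by (intros; now apply HN, EI).
  assert (Hm' : forall i, In i J -> N i <= N h) by (intros i Hi; apply Ropp_le_cancel, Hm, EI; now right).
  exists (star_potential h J N). split.
  - intros p j Hp Hj. rewrite ES. apply star_potential_range; auto; [now apply ED|now apply EI].
  - intros p a Hp Ha.
    destruct (star_step h J N HJ HN' Hm' p a) as [p' [Hp' H]];
      [now apply ED|intros; now apply Ha, EI|].
    exists p'. split; [now apply ED|]. intros j Hj. unfold tv. rewrite !ES.
    apply H. now apply EI.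
Qed.

(** * Couplings and gluing *)

Definition coupling (X : list nat) (x x' : nat -> R) (J : nat -> nat -> R) : Prop :=
  (forall a b, In a X -> In b X -> 0 <= J a b) /\
  (forall a, In a X -> lsum X (J a) = x a) /\
  (forall b, In b X -> lsum X (fun a => J a b) = x' b).

Definition coupling_cost (X : list nat) (D J : nat -> nat -> R) : R :=
  lsum X (fun a => lsum X (fun b => J a b * D a b)).

Lemma coupling_cost_nonneg X D x x' J :
  (forall a b, In a X -> In b X -> 0 <= D a b) -> coupling X x x' J ->
  0 <= coupling_cost X D J.
Proof.
  intros HD [HJ _]. apply lsum_nonneg. intros a Ha. apply lsum_nonneg. intros b Hb.
  apply Rmult_le_pos; auto.
Qed.

Section Mixture.

Variables (X I : list nat) (rep : nat -> nat).
Hypothesis NoDup_I : NoDup I.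
Hypothesis rep_in : forall z, In z X -> In (rep z) I.

Definition block (k : nat) : list nat := filter (fun z => Nat.eqb (rep z) k) X.

Lemma in_block k z : In z (block k) <-> In z X /\ rep z = k.
Proof. unfold block. now rewrite filter_In, Nat.eqb_eq. Qed.

Lemma lsum_block k f : lsum X (fun b => if Nat.eqb (rep b) k then f b else 0) = lsum (block k) f.
Proof. symmetry. apply lsum_filter. Qed.

Lemma lsum_mixture (w : nat -> R) (f : nat -> nat -> R) :
  lsum X (fun z => w (rep z) * f (rep z) z) = lsum I (fun k => w k * lsum (block k) (f k)).
Proof.
  rewrite (lsum_partition X I rep _ NoDup_I rep_in). apply lsum_ext. intros k Hk.
  rewrite <- lsum_scal. apply lsum_ext. intros z Hz. apply in_block in Hz.
  now destruct Hz as [_ ->].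
Qed.

Lemma mixture_dist p (y : nat -> nat -> R) :
  dist I p -> (forall k, In k I -> dist (block k) (y k)) ->
  dist X (fun z => p (rep z) * y (rep z) z).
Proof.
  intros Hp Hy. split.
  - intros z Hz. apply Rmult_le_pos; [now apply (proj1 Hp), rep_in|].
    apply (Hy (rep z) (rep_in z Hz)). now apply in_block.
  - rewrite lsum_mixture. rewrite <- (proj2 Hp). apply lsum_ext. intros k Hk.
    rewrite (proj2 (Hy k Hk)). ring.
Qed.

(** In block [k] the common mass, the minimum of [p k] and [p' k], follows [K k]. The surplus [e]
    and the deficit [f], both of mass [T], are coupled by their normalized product at distance at
    most [Del]. Block movement is thus charged at no more than the new weights [p' k], the weights
    of the service cost in the star. *)
Lemma mixture_coupling D Del p p' (y y' : nat -> nat -> R) (K : nat -> nat -> nat -> R) :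
  (forall a b, In a X -> In b X -> 0 <= D a b <= Del) ->
  dist I p -> dist I p' ->
  (forall k, In k I -> dist (block k) (y k)) ->
  (forall k, In k I -> dist (block k) (y' k)) ->
  (forall k, In k I -> coupling (block k) (y k) (y' k) (K k)) ->
  exists J, coupling X (fun z => p (rep z) * y (rep z) z) (fun z => p' (rep z) * y' (rep z) z) J /\
    coupling_cost X D J
    <= lsum I (fun k => p' k * coupling_cost (block k) D (K k)) + Del * tv I p p'.
Proof.
  intros HD Hp Hp' Hy Hy' HK.
  set (T := tv I p p').
  set (e := fun z => pos (p (rep z) - p' (rep z)) * y (rep z) z).
  set (f := fun z => pos (p' (rep z) - p (rep z)) * y' (rep z) z).
  set (m := fun k => Rmin (p k) (p' k)).
  assert (HT : T = lsum I (fun i => pos (p' i - p i))).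
  { apply tv_sym. now rewrite (proj2 Hp), (proj2 Hp'). }
  assert (He : forall z, In z X -> 0 <= e z).
  { intros z Hz. apply Rmult_le_pos; [apply pos_nonneg|].
    apply (Hy (rep z) (rep_in z Hz)). now apply in_block. }
  assert (Hf : forall z, In z X -> 0 <= f z).
  { intros z Hz. apply Rmult_le_pos; [apply pos_nonneg|].
    apply (Hy' (rep z) (rep_in z Hz)). now apply in_block. }
  assert (Se : lsum X e = T).
  { unfold e. rewrite (lsum_mixture (fun k => pos (p k - p' k)) y). apply lsum_ext.
    intros k Hk. rewrite (proj2 (Hy k Hk)). ring. }
  assert (Sf : lsum X f = T).
  { unfold f. rewrite (lsum_mixture (fun k => pos (p' k - p k)) y'), HT. apply lsum_ext.
    intros k Hk. rewrite (proj2 (Hy' k Hk)). ring. }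
  assert (HT0 : 0 <= T) by (apply lsum_nonneg; intros; apply pos_nonneg).
  (* If [T = 0] then [e] vanishes, so the value of the division by zero does not matter. *)
  assert (Ee : forall a, In a X -> lsum X (fun b => e a * f b / T) = e a).
  { intros a Ha.
    rewrite (lsum_ext X _ (fun b => e a / T * f b)) by (intros; unfold Rdiv; ring).
    rewrite lsum_scal, Sf. destruct HT0 as [H|H]; [field; lra|].
    assert (e a <= lsum X e) by now apply lsum_term_le.
    assert (e a = 0) by (generalize (He a Ha); lra). rewrite H1. unfold Rdiv. ring. }
  assert (Ef : forall b, In b X -> lsum X (fun a => e a * f b / T) = f b).
  { intros b Hb.
    rewrite (lsum_ext X _ (fun a => f b / T * e a)) by (intros; unfold Rdiv; ring).
    rewrite lsum_scal, Se. destruct HT0 as [H|H]; [field; lra|].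
    assert (f b <= lsum X f) by now apply lsum_term_le.
    assert (f b = 0) by (generalize (Hf b Hb); lra). rewrite H1. unfold Rdiv. ring. }
  assert (H0 : forall a b, In a X -> In b X -> 0 <= e a * f b / T).
  { intros a b Ha Hb. destruct HT0 as [H|H].
    - apply Rdiv_nonneg; [|assumption]. apply Rmult_le_pos; auto.
    - assert (e a <= lsum X e) by now apply lsum_term_le.
      assert (e a = 0) by (generalize (He a Ha); lra). rewrite H1. unfold Rdiv.
      right. ring. }
  assert (Hm : forall k, In k I -> 0 <= m k <= p' k).
  { intros k Hk. split; [|apply Rmin_r].
    apply Rmin_glb; [now apply (proj1 Hp)|now apply (proj1 Hp')]. }
  assert (Em : forall k, m k + pos (p k - p' k) = p k).
  { intros k. unfold m. destruct (Rle_dec (p k) (p' k)).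
    - rewrite Rmin_left, pos_of_nonpos; lra.
    - rewrite Rmin_right, pos_of_nonneg; lra. }
  assert (Em' : forall k, m k + pos (p' k - p k) = p' k).
  { intros k. generalize (Em k) (pos_minus (p k) (p' k)). lra. }
  exists (fun a b => (if Nat.eqb (rep b) (rep a) then m (rep a) * K (rep a) a b else 0)
                     + e a * f b / T).
  split; [split; [|split]|].
  - intros a b Ha Hb. apply Rplus_le_le_0_compat; [|now apply H0].
    destruct (Nat.eqb_spec (rep b) (rep a)) as [E|_]; [|apply Rle_refl].
    assert (Hk := rep_in a Ha). apply Rmult_le_pos; [now apply Hm|].
    apply (HK _ Hk); apply in_block; auto.
  - intros a Ha. rewrite lsum_plus, Ee, lsum_block, lsum_scal by assumption.
    assert (Hk := rep_in a Ha). destruct (HK _ Hk) as [_ [Hr _]].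
    rewrite Hr by now apply in_block. unfold e. now rewrite <- Rmult_plus_distr_r, Em.
  - intros b Hb. rewrite lsum_plus, Ef by assumption.
    rewrite (lsum_ext X _ (fun a => if Nat.eqb (rep a) (rep b)
                                    then m (rep b) * K (rep b) a b else 0)).
    2:{ intros a _. rewrite (Nat.eqb_sym (rep b)).
        destruct (Nat.eqb_spec (rep a) (rep b)) as [->|_]; reflexivity. }
    rewrite lsum_block, lsum_scal.
    assert (Hk := rep_in b Hb). destruct (HK _ Hk) as [_ [_ Hr]].
    rewrite Hr by now apply in_block. unfold f. now rewrite <- Rmult_plus_distr_r, Em'.
  - unfold coupling_cost at 1.
    rewrite (lsum_ext X _ (fun a =>
      m (rep a) * lsum (block (rep a)) (fun b => K (rep a) a b * D a b)
      + lsum X (fun b => e a * f b / T * D a b))).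
    2:{ intros a _. rewrite <- lsum_scal, <- lsum_block, <- lsum_plus. apply lsum_ext.
        intros b _. destruct (Nat.eqb (rep b) (rep a)); ring. }
    rewrite lsum_plus. apply Rplus_le_compat.
    + rewrite (lsum_mixture m (fun k a => lsum (block k) (fun b => K k a b * D a b))).
      apply lsum_le. intros k Hk. apply Rmult_le_compat_r; [|now apply Hm].
      apply (coupling_cost_nonneg _ D (y k) (y' k)); [|now apply HK].
      intros a b Ha Hb. apply in_block in Ha, Hb. now apply HD.
    + apply Rle_trans with (lsum X (fun a => Del * e a)).
      2:{ rewrite lsum_scal, Se. apply Rle_refl. }
      apply lsum_le. intros a Ha.
      apply Rle_trans with (Del * lsum X (fun b => e a * f b / T));
        [|rewrite Ee by assumption; apply Rle_refl].
      rewrite <- lsum_scal. apply lsum_le. intros b Hb. rewrite Rmult_comm.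
      apply Rmult_le_compat_r; [now apply H0|now apply HD].
Qed.

End Mixture.

(** * Amortized fractional algorithms and their composition *)

Definition size (X : list nat) : R := INR (length X).

Lemma lsum_one l : lsum l (fun _ => 1) = size l.
Proof.
  unfold size. induction l as [|a l IH]; [reflexivity|].
  rewrite lsum_cons, IH. simpl length. rewrite S_INR. ring.
Qed.

Lemma size_ge1 X z : In z X -> 1 <= size X.
Proof.
  intros Hz. rewrite <- lsum_one.
  apply (lsum_term_le X (fun _ => 1) z); [intros; lra|assumption].
Qed.

(* [x h] is the distribution on [X] after the cost functions in [h], latest first. *)
Definition amortized (D : nat -> nat -> R) (X : list nat) (Del : R)
    (x Phi : list (nat -> R) -> nat -> R) : Prop :=
  (forall h, dist X (x h)) /\
  (forall h z, In z X -> 0 <= Phi h z <= 48 * ratio (size X) * Del) /\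
  (forall h z z', In z X -> In z' X -> Phi h z' - Phi h z <= 96 * ratio (size X) * D z z') /\
  (forall h c, (forall z, In z X -> 0 <= c z) ->
     exists J, coupling X (x h) (x (c :: h)) J /\
       forall z, In z X ->
         lsum X (fun i => c i * x (c :: h) i) + coupling_cost X D J + Phi (c :: h) z - Phi h z
         <= ratio (size X) * c z).

Definition solvable (D : nat -> nat -> R) (X : list nat) (Del : R) : Prop :=
  exists x Phi, amortized D X Del x Phi.

Lemma solvable_singleton D a Del : D a a = 0 -> 0 <= Del -> solvable D [a] Del.
Proof.
  intros HD HDel. exists (fun _ _ => 1), (fun _ _ => 0).
  assert (Hr : 4 <= ratio (size [a])) by (apply ratio_ge4; unfold size; simpl; lra).
  split; [|split; [|split]].
  - intros h. split; [intros; lra|]. simpl. ring.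
  - intros h z _. split; [lra|]. apply Rmult_le_pos; lra.
  - intros h z z' [<-|[]] [<-|[]]. rewrite HD. lra.
  - intros h c Hc. exists (fun _ _ => 1). split; [split; [|split]|].
    + intros; lra.
    + intros; simpl; ring.
    + intros; simpl; ring.
    + intros z [<-|[]]. assert (H := Hc a (or_introl eq_refl)).
      unfold coupling_cost. simpl. rewrite HD. nra.
Qed.

(** Scaling the potential of block [k] by [ratio (size X) / ratio (N k)] turns its guarantee into
    exactly the amount that the star charges unfairly. The range constant 48 is 24 from the block,
    whose diameter is halved, plus 24 from [Psi]. *)
Lemma solvable_glue D X I rep Del :
  NoDup I -> (forall z, In z X -> In (rep z) I) ->
  (forall k, In k I -> exists z, In z X /\ rep z = k) ->
  X <> [] -> 0 < Del ->
  (forall a b, In a X -> In b X -> 0 <= D a b <= Del) ->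
  (forall a b, In a X -> In b X -> rep a <> rep b -> Del / 2 < D a b) ->
  (forall k, In k I -> solvable D (block X rep k) (Del / 2)) ->
  solvable D X Del.
Proof.
  intros HI Hrep Hsurj HX HDel HD Hsep Hblk.
  set (N := fun k => size (block X rep k)).
  assert (HN : forall k, In k I -> 1 <= N k).
  { intros k Hk. destruct (Hsurj k Hk) as [z [Hz Ez]].
    apply (size_ge1 _ z). now apply in_block. }
  assert (EN : lsum I N = size X).
  { rewrite <- lsum_one, (lsum_partition X I rep _ HI Hrep). apply lsum_ext.
    intros k _. unfold N. now rewrite <- lsum_one. }
  assert (HI0 : exists k0, In k0 I).
  { destruct X as [|z X']; [congruence|]. exists (rep z). apply Hrep. now left. }
  destruct HI0 as [k0 Hk0].
  assert (HI1 : I <> []) by (intros E; rewrite E in Hk0; destruct Hk0).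
  destruct (unfair_star I N HI HI1 HN) as [Psi [HPsi Hstar]]. rewrite EN in HPsi, Hstar.
  (* Choice needs a total relation, so indices outside [I] get dummy values. *)
  assert (Hsol : forall k, exists G : (list (nat -> R) -> nat -> R) * (list (nat -> R) -> nat -> R),
    In k I -> amortized D (block X rep k) (Del / 2) (fst G) (snd G)).
  { intros k. destruct (classic (In k I)) as [Hk|Hk].
    - destruct (Hblk k Hk) as [x [Phi H]]. now exists (x, Phi).
    - exists (fun _ _ => 0, fun _ _ => 0). intros; contradiction. }
  apply functional_choice in Hsol. destruct Hsol as [G HG].
  set (xs := fun k => fst (G k)). set (Fs := fun k => snd (G k)).
  assert (HJ : forall q : nat * (list (nat -> R) * (nat -> R)), exists K : nat -> nat -> R,
    let k := fst q in let h := fst (snd q) in let c := snd (snd q) in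
    In k I -> (forall z, In z (block X rep k) -> 0 <= c z) ->
    coupling (block X rep k) (xs k h) (xs k (c :: h)) K /\
    forall z, In z (block X rep k) ->
      lsum (block X rep k) (fun i => c i * xs k (c :: h) i) + coupling_cost (block X rep k) D K
      + Fs k (c :: h) z - Fs k h z <= ratio (N k) * c z).
  { intros [k [h c]]. simpl.
    destruct (classic (In k I /\ forall z, In z (block X rep k) -> 0 <= c z)) as [[Hk Hc]|Hn].
    - destruct (HG k Hk) as (_ & _ & _ & H). destruct (H h c Hc) as [K HK]. now exists K.
    - exists (fun _ _ => 0). intros; tauto. }
  apply functional_choice in HJ. destruct HJ as [JJ HJ].
  set (K := fun k h c => JJ (k, (h, c))).
  assert (HK := fun k h c => HJ (k, (h, c))). simpl in HK. clear HJ.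
  (* That [p'] is a distribution is claimed whatever the signs of the losses, so that [pr h] is one
     for every history; if some loss is negative, the mass stays at [p]. *)
  assert (Hst : forall q : (nat -> R) * (nat -> R), exists p', dist I (fst q) ->
    dist I p' /\ ((forall i, In i I -> 0 <= snd q i) -> forall j, In j I ->
      lsum I (fun i => p' i * snd q i) + tv I (fst q) p' + Psi p' j - Psi (fst q) j
      <= ratio (size X) / ratio (N j) * snd q j)).
  { intros [p a]. simpl.
    destruct (classic (dist I p /\ forall i, In i I -> 0 <= a i)) as [[Hp Ha]|Hn].
    - destruct (Hstar p a Hp Ha) as [p' [Hp' H]]. exists p'. auto.
    - exists p. intros Hp. split; [assumption|]. intros; tauto. }
  apply functional_choice in Hst. destruct Hst as [st Hst].
  (* The star has unit distances, hence the division by [Del]. The loss includes the movement of the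
     block algorithm in response to [c]. *)
  set (a := fun (h : list (nat -> R)) (c : nat -> R) k =>
    (lsum (block X rep k) (fun i => c i * xs k (c :: h) i)
     + coupling_cost (block X rep k) D (K k h c)) / Del).
  set (pr := fix pr (h : list (nat -> R)) : nat -> R :=
    match h with
    | [] => fun i => if Nat.eqb k0 i then 1 else 0
    | c :: h' => st (pr h', a h' c)
    end).
  assert (Hpr : forall h, dist I (pr h)).
  { induction h as [|c h IH].
    - split; [intros i _; simpl; destruct (Nat.eqb k0 i); lra|].
      apply (lsum_indicator I k0 (fun _ => 1) HI Hk0).
    - apply (Hst (pr h, a h c) IH). }
  assert (HDb : forall k u v, In u (block X rep k) -> In v (block X rep k) -> 0 <= D u v).
  { intros k u v Hu Hv. apply in_block in Hu, Hv. now apply HD. }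
  assert (HrN : forall k, In k I -> 4 <= ratio (N k)) by (intros; now apply ratio_ge4, HN).
  assert (Hr : 4 <= ratio (size X)).
  { destruct X as [|z X']; [congruence|]. apply ratio_ge4, (size_ge1 _ z). now left. }
  assert (Hxs : forall k h, In k I -> dist (block X rep k) (xs k h))
    by (intros k h Hk; apply (HG k Hk)).
  assert (Hin : forall z, In z X -> In z (block X rep (rep z))) by (intros; now apply in_block).
  exists (fun h z => pr h (rep z) * xs (rep z) h z).
  exists (fun h z => ratio (size X) / ratio (N (rep z)) * Fs (rep z) h z + Del * Psi (pr h) (rep z)).
  assert (Hscale : forall k v B, In k I -> v <= B * ratio (N k) ->
    ratio (size X) / ratio (N k) * v <= B * ratio (size X)).
  { intros k v B Hk Hv. assert (H4 := HrN k Hk).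
    replace (B * ratio (size X)) with (ratio (size X) / ratio (N k) * (B * ratio (N k)))
      by (field; lra).
    apply Rmult_le_compat_l; [apply Rdiv_nonneg; lra|assumption]. }
  assert (Hrange : forall h z, In z X ->
    0 <= ratio (size X) / ratio (N (rep z)) * Fs (rep z) h z + Del * Psi (pr h) (rep z)
      <= 48 * ratio (size X) * Del).
  { intros h z Hz. assert (Hk := Hrep z Hz). assert (H4 := HrN _ Hk).
    destruct (HG _ Hk) as (_ & HF & _ & _). specialize (HF h z (Hin z Hz)).
    assert (HP := HPsi (pr h) (rep z) (Hpr h) Hk).
    fold (N (rep z)) in HF. change (snd (G (rep z)) h z) with (Fs (rep z) h z) in HF.
    split.
    - apply Rplus_le_le_0_compat; apply Rmult_le_pos; try lra. apply Rdiv_nonneg; lra.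
    - assert (ratio (size X) / ratio (N (rep z)) * Fs (rep z) h z <= 24 * Del * ratio (size X))
        by (apply Hscale; [assumption|lra]).
      assert (Del * Psi (pr h) (rep z) <= Del * (24 * ratio (size X)))
        by (apply Rmult_le_compat_l; lra).
      lra. }
  split; [|split; [|split]].
  - intros h. apply (mixture_dist X I rep HI Hrep (pr h) (fun k => xs k h)); auto.
  - exact Hrange.
  - intros h z z' Hz Hz'. destruct (Nat.eq_dec (rep z) (rep z')) as [E|Hne].
    + rewrite <- E. assert (Hk := Hrep z Hz).
      destruct (HG _ Hk) as (_ & _ & HL & _).
      assert (Hz2 : In z' (block X rep (rep z))) by (apply in_block; auto).
      specialize (HL h z z' (Hin z Hz) Hz2).
      replace (96 * ratio (size (block X rep (rep z))) * D z z')
        with (96 * D z z' * ratio (N (rep z))) in HL by (unfold N; ring).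
      assert (H := Hscale (rep z) _ (96 * D z z') Hk HL).
      unfold Fs. lra.
    (* Across blocks the distance exceeds [Del / 2], so the range constant 48 yields the Lipschitz
       constant 96. *)
    + assert (H1 := Hrange h z Hz). assert (H2 := Hrange h z' Hz').
      assert (H3 := Hsep z z' Hz Hz' Hne).
      assert (48 * ratio (size X) * Del <= 96 * ratio (size X) * D z z').
      { replace (48 * ratio (size X) * Del) with (96 * ratio (size X) * (Del / 2)) by field.
        apply Rmult_le_compat_l; lra. }
      lra.
  - intros h c Hc.
    assert (Hcb : forall k z, In z (block X rep k) -> 0 <= c z).
    { intros k z Hz. apply in_block in Hz. now apply Hc. }
    destruct (mixture_coupling X I rep HI Hrep D Del (pr h) (pr (c :: h)) (fun k => xs k h)
      (fun k => xs k (c :: h)) (fun k => K k h c) HD (Hpr h) (Hpr (c :: h))) as [J [HJ HJc]].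
    { auto. }
    { auto. }
    { intros k Hk. apply (HK k h c Hk (Hcb k)). }
    exists J. split; [exact HJ|]. intros z Hz. assert (Hk := Hrep z Hz).
    assert (Ha : forall k, In k I -> 0 <= a h c k).
    { intros k Hk'. apply Rdiv_nonneg; [|assumption]. apply Rplus_le_le_0_compat.
      - apply lsum_nonneg. intros i Hi. apply Rmult_le_pos; [now apply (Hcb k)|].
        now apply (Hxs k (c :: h) Hk').
      - apply (coupling_cost_nonneg _ D (xs k h) (xs k (c :: h))); [now apply HDb|].
        apply (HK k h c Hk' (Hcb k)). }
    destruct (Hst (pr h, a h c) (Hpr h)) as [_ Hs]. specialize (Hs Ha (rep z) Hk).
    simpl fst in Hs. simpl snd in Hs.
    change (st (pr h, a h c)) with (pr (c :: h)) in Hs.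
    destruct (HK _ h c Hk (Hcb _)) as [_ HF]. specialize (HF z (Hin z Hz)).
    assert (H4 := HrN _ Hk).
    rewrite (Rmult_comm _ (c z)) in HF.
    assert (Hx := Hscale (rep z) _ (c z) Hk HF). fold (K (rep z) h c) in Hx.
    assert (EX : lsum X (fun i => c i * (pr (c :: h) (rep i) * xs (rep i) (c :: h) i)) =
      lsum I (fun k => pr (c :: h) k * lsum (block X rep k) (fun i => c i * xs k (c :: h) i))).
    { rewrite <- (lsum_mixture X I rep HI Hrep (pr (c :: h)) (fun k i => c i * xs k (c :: h) i)).
      apply lsum_ext. intros; ring. }
    rewrite EX. clear EX.
    apply Rmult_le_compat_l with (r := Del) in Hs; [|lra].
    assert (ES : Del * lsum I (fun i => pr (c :: h) i * a h c i) =
      lsum I (fun k => pr (c :: h) k * lsum (block X rep k) (fun i => c i * xs k (c :: h) i))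
      + lsum I (fun k => pr (c :: h) k * coupling_cost (block X rep k) D (K k h c))).
    { rewrite <- lsum_scal, <- lsum_plus. apply lsum_ext. intros k _. unfold a. field. lra. }
    assert (Er : Del * (ratio (size X) / ratio (N (rep z)) * a h c (rep z)) =
      ratio (size X) / ratio (N (rep z)) *
        (lsum (block X rep (rep z)) (fun i => c i * xs (rep z) (c :: h) i)
         + coupling_cost (block X rep (rep z)) D (K (rep z) h c)))
      by (unfold a; field; lra).
    lra.
Qed.

(** * Ultrametrics *)

Definition ultrametric_on {A : Type} (X : list A) (D : A -> A -> R) : Prop :=
  (forall a, In a X -> D a a = 0) /\
  (forall a b, In a X -> In b X -> a <> b -> 0 < D a b) /\
  (forall a b, In a X -> In b X -> D a b = D b a) /\
  (forall a b c, In a X -> In b X -> In c X -> D a c <= Rmax (D a b) (D b c)).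

Lemma ultrametric_incl {A} (X Y : list A) D :
  incl Y X -> ultrametric_on X D -> ultrametric_on Y D.
Proof. intros H (H1 & H2 & H3 & H4). repeat split; intros; auto. Qed.

Lemma ultrametric_nonneg X (D : nat -> nat -> R) a b :
  ultrametric_on X D -> In a X -> In b X -> 0 <= D a b.
Proof.
  intros (H1 & H2 & _) Ha Hb. destruct (Nat.eq_dec a b) as [<-|Hne].
  - rewrite H1 by assumption. apply Rle_refl.
  - left. now apply H2.
Qed.

Definition near (D : nat -> nat -> R) (r : R) (z y : nat) : bool :=
  if Rle_dec (D z y) r then true else false.

Lemma near_spec D r z y : near D r z y = true <-> D z y <= r.
Proof. unfold near. destruct (Rle_dec (D z y) r); split; intros; auto; congruence. Qed.

(** In an ultrametric this depends only on the closed ball of radius [r] around [z], and so names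
    the ball canonically. *)
Definition ball_rep (D : nat -> nat -> R) (X : list nat) (r : R) (z : nat) : nat :=
  match find (near D r z) X with Some y => y | None => z end.

Lemma find_ext_in {A} (f g : A -> bool) l :
  (forall x, In x l -> f x = g x) -> find f l = find g l.
Proof.
  induction l as [|a l IH]; intros H; [reflexivity|]. simpl.
  rewrite (H a (or_introl eq_refl)), IH; [reflexivity|]. intros; apply H; now right.
Qed.

Lemma ball_rep_spec D X r z : ultrametric_on X D -> 0 <= r -> In z X ->
  In (ball_rep D X r z) X /\ D z (ball_rep D X r z) <= r.
Proof.
  intros HU Hr Hz. unfold ball_rep. destruct (find (near D r z) X) as [y|] eqn:E.
  - apply find_some in E. now rewrite near_spec in E.
  - apply find_none with (x := z) in E; [|assumption].
    assert (near D r z z = true); [|congruence].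
    apply near_spec. rewrite (proj1 HU); assumption.
Qed.

Lemma ball_rep_eq D X r z z' : ultrametric_on X D -> In z X -> In z' X ->
  D z z' <= r -> ball_rep D X r z = ball_rep D X r z'.
Proof.
  intros (_ & _ & HS & HU) Hz Hz' H. unfold ball_rep.
  rewrite (find_ext_in (near D r z) (near D r z')).
  - destruct (find (near D r z') X) eqn:E; [reflexivity|].
    apply find_none with (x := z) in E; [|assumption].
    assert (near D r z' z = true); [|congruence]. apply near_spec. now rewrite HS.
  - intros y Hy. apply Bool.eq_true_iff_eq. rewrite !near_spec. split; intros H1.
    + eapply Rle_trans; [apply (HU z' z y); assumption|]. apply Rmax_lub; [rewrite HS|]; assumption.
    + eapply Rle_trans; [apply (HU z z' y); assumption|]. now apply Rmax_lub.
Qed.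

(** [L] counts halvings of the diameter: at 0 two distinct points would be farther apart than [Del],
    so [X] is a singleton. Otherwise the closed balls of radius [Del / 2] partition [X] into blocks
    more than [Del / 2] apart. *)
Lemma solvable_levels D L : forall X Del,
  ultrametric_on X D -> NoDup X -> X <> [] -> 0 < Del ->
  (forall a b, In a X -> In b X -> D a b <= Del) ->
  (forall a b, In a X -> In b X -> a <> b -> Del / 2 ^ L < D a b) ->
  solvable D X Del.
Proof.
  induction L as [|L IH]; intros X Del HU HN HX HDel Hd Hs.
  - destruct X as [|a [|b X]]; [congruence| |].
    + apply solvable_singleton; [apply HU; now left|lra].
    + assert (Hab : a <> b) by (apply NoDup_cons_iff in HN; intros ->; apply (proj1 HN); now left).
      assert (H1 := Hs a b (or_introl eq_refl) (or_intror (or_introl eq_refl)) Hab).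
      assert (H2 := Hd a b (or_introl eq_refl) (or_intror (or_introl eq_refl))).
      simpl in H1. lra.
  - set (rep := ball_rep D X (Del / 2)).
    assert (Hrep : forall z, In z X -> In (rep z) X /\ D z (rep z) <= Del / 2)
      by (intros; apply ball_rep_spec; auto; lra).
    set (I := nodup Nat.eq_dec (map rep X)).
    assert (HIin : forall k, In k I <-> exists z, In z X /\ rep z = k).
    { intros k. unfold I. rewrite nodup_In, in_map_iff. split; intros [z [H1 H2]]; exists z; auto. }
    apply (solvable_glue D X I rep Del); auto.
    + apply NoDup_nodup.
    + intros z Hz. apply HIin. now exists z.
    + intros k Hk. now apply HIin.
    + intros a b Ha Hb. split; [now apply (ultrametric_nonneg X)|now apply Hd].
    + intros a b Ha Hb Hne. destruct (Rlt_le_dec (Del / 2) (D a b)) as [H|H]; [assumption|].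
      exfalso. apply Hne. now apply ball_rep_eq.
    + intros k Hk. apply HIin in Hk. destruct Hk as [z0 [Hz0 Ek]].
      assert (Hincl : incl (block X rep k) X)
        by (intros z Hz; now apply in_block in Hz).
      apply IH.
      * now apply (ultrametric_incl X).
      * now apply NoDup_filter.
      * intros E. assert (H : In z0 (block X rep k)) by now apply in_block.
        rewrite E in H. destruct H.
      * lra.
      * intros a b Ha Hb. apply in_block in Ha, Hb. destruct Ha as [Ha Ea], Hb as [Hb Eb].
        destruct HU as (_ & _ & HS & HU).
        apply Rle_trans with (Rmax (D a k) (D k b)).
        -- apply HU; auto. rewrite <- Ek. now apply Hrep.
        -- apply Rmax_lub; [rewrite <- Ea; now apply Hrep|].
           rewrite HS; auto; [rewrite <- Eb; now apply Hrep|]. rewrite <- Ek. now apply Hrep.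
      * intros a b Ha Hb Hne. replace (Del / 2 / 2 ^ L) with (Del / 2 ^ S L).
        -- apply Hs; auto.
        -- simpl. field. apply pow_nonzero. lra.
Qed.

Lemma solvable_ultrametric D X :
  ultrametric_on X D -> NoDup X -> X <> [] -> exists Del, solvable D X Del.
Proof.
  intros HU HN HX.
  set (P := list_prod X X).
  assert (HP : P <> []).
  { destruct X as [|a X]; [congruence|]. discriminate. }
  (* Diagonal pairs get the value 1, so that the minimum is positive. *)
  destruct (exists_min P (fun q => if Nat.eq_dec (fst q) (snd q) then 1 else D (fst q) (snd q)) HP)
    as [[a1 b1] [H1 Hmin]].
  destruct (exists_min P (fun q => - D (fst q) (snd q)) HP) as [[a2 b2] [H2 Hmax]].
  unfold P in H1, H2. apply in_prod_iff in H1, H2. simpl in Hmin, Hmax.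
  set (m := if Nat.eq_dec a1 b1 then 1 else D a1 b1) in Hmin.
  assert (Hm : 0 < m).
  { unfold m. destruct (Nat.eq_dec a1 b1); [lra|]. now apply HU. }
  set (Del := 1 + D a2 b2).
  assert (HD2 : 0 <= D a2 b2) by (apply (ultrametric_nonneg X); tauto).
  destruct (INR_unbounded (Del / m)) as [L HL]. exists Del.
  apply (solvable_levels D L); auto.
  - unfold Del; lra.
  - intros a b Ha Hb. assert (H := Hmax (a, b) ltac:(now apply in_prod)). simpl in H.
    unfold Del. lra.
  - intros a b Ha Hb Hne. assert (H := Hmin (a, b) ltac:(now apply in_prod)). simpl in H.
    destruct (Nat.eq_dec a b); [congruence|].
    eapply Rlt_le_trans; [|exact H].
    (* Bernoulli's inequality: [2 ^ L] is at least [1 + INR L], which exceeds [Del / m]. *)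
    assert (H0 := poly L 1 ltac:(lra)). replace (1 + 1) with 2 in H0 by lra.
    assert (Hp : 0 < 2 ^ L) by (apply pow_lt; lra).
    apply Rmult_lt_reg_r with (2 ^ L); [assumption|].
    replace (Del / 2 ^ L * 2 ^ L) with (Del / m * m) by (field; lra).
    rewrite (Rmult_comm m). apply Rmult_lt_compat_r; lra.
Qed.

(** * Trees *)

(** The generated principle has no induction hypothesis for the trees inside the list of
    children. *)
Lemma tree_nested_ind (P : tree -> Prop) :
  (forall cs, (forall w c, In (w, c) cs -> P c) -> P (Node cs)) -> forall t, P t.
Proof.
  intros H. fix F 1. intros [cs]. apply H.
  induction cs as [|[w0 c0] cs IH]; intros w c Hin; [destruct Hin|].
  destruct Hin as [E|Hin].
  - injection E as _ <-. apply F.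
  - exact (IH w c Hin).
Qed.

(** The inner fixpoint of [leaves], named so that inductions can vary the starting index. *)
Definition leaves_from : nat -> list (R * tree) -> list path :=
  fix go (i : nat) (l : list (R * tree)) : list path :=
    match l with
    | [] => []
    | (w, c) :: r => map (cons (i, w)) (leaves c) ++ go (S i) r
    end.

Lemma leaves_node x cs : leaves (Node (x :: cs)) = leaves_from 0 (x :: cs).
Proof. reflexivity. Qed.

Lemma in_leaves_from cs : forall i p, In p (leaves_from i cs) <->
  exists j w c q, nth_error cs j = Some (w, c) /\ p = ((i + j)%nat, w) :: q /\ In q (leaves c).
Proof.
  induction cs as [|[w0 c0] cs IH]; intros i p.
  - simpl. split; [tauto|]. intros (j & w & c & q & H & _). destruct j; discriminate.
  - simpl leaves_from. rewrite in_app_iff, in_map_iff, IH. split.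
    + intros [(q & <- & Hq)|(j & w & c & q & H & -> & Hq)].
      * exists 0%nat, w0, c0, q. rewrite Nat.add_0_r. auto.
      * exists (S j), w, c, q. split; [assumption|]. split; [f_equal; f_equal; lia|assumption].
    + intros ([|j] & w & c & q & H & -> & Hq).
      * left. injection H as -> ->. exists q. rewrite Nat.add_0_r. auto.
      * right. exists j, w, c, q. split; [assumption|]. split; [f_equal; f_equal; lia|assumption].
Qed.

Lemma in_leaves_node x cs p : In p (leaves (Node (x :: cs))) <->
  exists i w c q, nth_error (x :: cs) i = Some (w, c) /\ p = (i, w) :: q /\ In q (leaves c).
Proof. rewrite leaves_node. apply (in_leaves_from (x :: cs) 0). Qed.

Lemma leaves_nonempty t : leaves t <> [].
Proof.
  induction t as [[|[w c] cs] IH] using tree_nested_ind; [discriminate|].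
  rewrite leaves_node. simpl. assert (H := IH w c (or_introl eq_refl)).
  destruct (leaves c); [congruence|discriminate].
Qed.

Lemma NoDup_leaves t : NoDup (leaves t).
Proof.
  induction t as [cs IH] using tree_nested_ind. destruct cs as [|x cs].
  - repeat constructor. simpl; tauto.
  - rewrite leaves_node. revert IH. generalize (x :: cs) 0%nat. clear x cs.
    induction l as [|[w c] l IHl]; intros i IH; [constructor|].
    simpl. apply NoDup_app.
    + apply FinFun.Injective_map_NoDup; [intros a b E; congruence|]. apply (IH w c). now left.
    + apply IHl. intros w' c' H. apply (IH w' c'). now right.
    + intros p Hp Hp'. apply in_map_iff in Hp. destruct Hp as (q & <- & _).
      apply in_leaves_from in Hp'. destruct Hp' as (j & w' & c' & q' & _ & E & _).
      injection E as E _ _. lia.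
Qed.

Lemma is_HST_child tau cs w c : is_HST tau (Node cs) -> In (w, c) cs ->
  0 < w /\ (forall p q, In p (leaves c) -> In q (leaves c) -> pdist p q <= w / tau) /\
  is_HST tau c.
Proof.
  induction cs as [|[w0 c0] cs IH]; intros H Hin; [destruct Hin|].
  destruct H as (H1 & H2 & H3 & H4). destruct Hin as [E|Hin].
  - injection E as <- <-. auto.
  - now apply IH.
Qed.

Lemma pathw_nonneg tau t p : is_HST tau t -> In p (leaves t) -> 0 <= pathw p.
Proof.
  revert p. induction t as [[|x cs] IH] using tree_nested_ind; intros p Ht Hp.
  - destruct Hp as [<-|[]]. apply Rle_refl.
  - apply in_leaves_node in Hp. destruct Hp as (i & w & c & q & Hi & -> & Hq).
    apply nth_error_In in Hi. destruct (is_HST_child _ _ _ _ Ht Hi) as (Hw & _ & Hc).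
    assert (H := IH w c Hi q Hc Hq). simpl. lra.
Qed.

(** The common prefix cancels, and below the branching [pdist] contains the whole rest of [q]. *)
Lemma pathw_le tau t p q : is_HST tau t -> In p (leaves t) -> In q (leaves t) ->
  pathw q <= pathw p + pdist p q.
Proof.
  revert p q. induction t as [[|x cs] IH] using tree_nested_ind; intros p q Ht Hp Hq.
  - destruct Hp as [<-|[]]. destruct Hq as [<-|[]]. simpl. lra.
  - assert (Hp0 := pathw_nonneg _ _ _ Ht Hp). assert (Hq0 := pathw_nonneg _ _ _ Ht Hq).
    apply in_leaves_node in Hp, Hq.
    destruct Hp as (i & w & c & p' & Hi & -> & Hp). destruct Hq as (j & v & e & q' & Hj & -> & Hq).
    simpl in Hp0, Hq0 |- *. destruct (Nat.eqb_spec i j) as [<-|Hne]; [|lra].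
    rewrite Hi in Hj. injection Hj as <- <-. apply nth_error_In in Hi.
    destruct (is_HST_child _ _ _ _ Ht Hi) as (Hw & _ & Hc).
    assert (H := IH w c Hi p' q' Hc Hp Hq). lra.
Qed.

(* At a branching into children [i <> j], [D] is [max (m i) (m j)], where [m i] is the
   least path weight through child [i]. *)
Lemma tree_ultrametric tau t : 1 < tau -> is_HST tau t ->
  exists D : path -> path -> R, ultrametric_on (leaves t) D /\
    forall p q, In p (leaves t) -> In q (leaves t) -> D p q <= pdist p q <= 4 * D p q.
Proof.
  intros Htau. induction t as [cs IH] using tree_nested_ind. intros Ht.
  destruct cs as [|x cs].
  { exists (fun _ _ => 0). split; [split; [|split; [|split]]|].
    - reflexivity.
    - intros a b [<-|[]] [<-|[]] H. congruence.
    - reflexivity.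
    - intros. apply Rmax_l.
    - intros a b [<-|[]] [<-|[]]. simpl. lra. }
  (* [snd E] becomes [m i], the edge weight plus the least path weight below. As [w / tau <= w], the
     diameter bound puts the depth of every leaf below child [i] between [m i] and [2 * m i]. *)
  assert (HC : forall i, exists E : (path -> path -> R) * R, forall w c,
    nth_error (x :: cs) i = Some (w, c) ->
    (ultrametric_on (leaves c) (fst E) /\
     forall p q, In p (leaves c) -> In q (leaves c) -> fst E p q <= pdist p q <= 4 * fst E p q) /\
    0 < w <= snd E /\
    (forall p q, In p (leaves c) -> In q (leaves c) -> pdist p q <= snd E) /\
    forall p, In p (leaves c) -> snd E <= w + pathw p <= 2 * snd E).
  { intros i. destruct (nth_error (x :: cs) i) as [[w c]|] eqn:Ei.
    2:{ exists (fun _ _ => 0, 0). intros; discriminate. }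
    apply nth_error_In in Ei. destruct (is_HST_child _ _ _ _ Ht Ei) as (Hw & Hdm & Hc).
    destruct (IH w c Ei Hc) as [D HD].
    destruct (exists_min (leaves c) pathw (leaves_nonempty c)) as [p0 [Hp0 Hmin]].
    assert (Hn := pathw_nonneg _ _ _ Hc Hp0).
    assert (Hwt : w / tau <= w).
    { apply Rmult_le_reg_r with tau; [lra|]. replace (w / tau * tau) with w by (field; lra). nra. }
    exists (D, w + pathw p0). intros w' c' E. injection E as <- <-. simpl fst. simpl snd.
    split; [exact HD|]. split; [lra|]. split.
    - intros p q Hp Hq. generalize (Hdm p q Hp Hq). lra.
    - intros p Hp. generalize (Hmin p Hp) (pathw_le _ _ p0 p Hc Hp0 Hp) (Hdm p0 p Hp0 Hp). lra. }
  apply functional_choice in HC. destruct HC as [E HE].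
  set (Dc := fun i => fst (E i)). set (m := fun i => snd (E i)).
  exists (fun p q => match p, q with
    | (i, _) :: p', (j, _) :: q' => if Nat.eqb i j then Dc i p' q' else Rmax (m i) (m j)
    | _, _ => 0
    end).
  split; [split; [|split; [|split]]|].
  - intros a Ha. apply in_leaves_node in Ha. destruct Ha as (i & w & c & p & Hi & -> & Hp).
    rewrite Nat.eqb_refl. destruct (HE i w c Hi) as ((HU & _) & _). now apply HU.
  - intros a b Ha Hb Hne. apply in_leaves_node in Ha, Hb.
    destruct Ha as (i & w & c & p & Hi & -> & Hp). destruct Hb as (j & v & e & q & Hj & -> & Hq).
    destruct (HE i w c Hi) as ((HU & _) & Hw & _).
    destruct (Nat.eqb_spec i j) as [<-|Hij].
    + rewrite Hi in Hj. injection Hj as <- <-. apply HU; auto. congruence.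
    + apply Rlt_le_trans with (m i); [unfold m; lra|apply Rmax_l].
  - intros a b Ha Hb. apply in_leaves_node in Ha, Hb.
    destruct Ha as (i & w & c & p & Hi & -> & Hp). destruct Hb as (j & v & e & q & Hj & -> & Hq).
    rewrite (Nat.eqb_sym j i). destruct (Nat.eqb_spec i j) as [<-|Hij]; [|apply Rmax_comm].
    rewrite Hi in Hj. injection Hj as <- <-.
    destruct (HE i w c Hi) as ((HU & _) & _). now apply HU.
  - intros a b d Ha Hb Hd. apply in_leaves_node in Ha, Hb, Hd.
    destruct Ha as (i & w & c & p & Hi & -> & Hp). destruct Hb as (j & v & e & q & Hj & -> & Hq).
    destruct Hd as (k & u & f & r & Hk & -> & Hr).
    assert (Hmi := Rmax_l (m i) (m j)). assert (Hmj := Rmax_r (m i) (m j)).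
    destruct (Nat.eqb_spec i k) as [<-|Hik]; destruct (Nat.eqb_spec i j) as [<-|Hij].
    + rewrite Hi in Hj, Hk. injection Hj as <- <-. injection Hk as <- <-.
      rewrite Nat.eqb_refl. destruct (HE i w c Hi) as ((HU & _) & _). now apply HU.
    + rewrite Hi in Hk. injection Hk as <- <-.
      destruct (HE i w c Hi) as ((_ & HD) & _ & Hm & _).
      (* Leaves below child [i] are within [m i] of each other, and [D] to a leaf below another
         child is at least [m i]. *)
      apply Rle_trans with (m i).
      * apply Rle_trans with (pdist p r); [now apply HD|now apply Hm].
      * apply Rle_trans with (Rmax (m i) (m j)); [assumption|apply Rmax_l].
    + destruct (Nat.eqb_spec i k) as [E1|_]; [contradiction|]. apply Rmax_r.
    + destruct (Nat.eqb_spec j k) as [<-|Hjk]; [apply Rmax_l|].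
      apply Rmax_lub.
      * apply Rle_trans with (Rmax (m i) (m j)); [assumption|apply Rmax_l].
      * apply Rle_trans with (Rmax (m j) (m k)); apply Rmax_r.
  - intros a b Ha Hb. apply in_leaves_node in Ha, Hb.
    destruct Ha as (i & w & c & p & Hi & -> & Hp). destruct Hb as (j & v & e & q & Hj & -> & Hq).
    destruct (HE i w c Hi) as ((_ & HD) & Hwi & _ & Hmi).
    destruct (HE j v e Hj) as (_ & Hwj & _ & Hmj).
    specialize (Hmi p Hp). specialize (Hmj q Hq). fold (m i) in *. fold (m j) in *.
    simpl. destruct (Nat.eqb_spec i j) as [<-|Hij].
    + rewrite Hi in Hj. injection Hj as <- <-. now apply HD.
    (* [pdist] is now the sum of two depths, hence between [m i + m j] and [2 * (m i + m j)], which
       is at most 4 times the larger. *)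
    + assert (H1 := Rmax_l (m i) (m j)). assert (H2 := Rmax_r (m i) (m j)).
      split; [|lra]. apply Rmax_lub; lra.
Qed.

(** * The randomized algorithm *)

Lemma minX_attained n f : (1 <= n)%nat -> exists x, In x (seq 0 n) /\ minX n f = f x.
Proof.
  intros Hn.
  assert (H : forall l, exists x, (x = 0%nat \/ In x l) /\
    fold_right (fun i m => Rmin (f i) m) (f 0%nat) l = f x).
  { induction l as [|a l [x [Hx E]]].
    - exists 0%nat. auto.
    - simpl. rewrite E. destruct (Rle_dec (f a) (f x)).
      + exists a. rewrite Rmin_left by assumption. auto.
      + exists x. rewrite Rmin_right by lra. intuition. }
  destruct (H (seq 1 (n - 1))) as [x [Hx E]]. exists x. split; [|exact E].
  destruct Hx as [->|Hx]; [|apply in_seq in Hx]; apply in_seq; lia.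
Qed.

(** Conditional laws of the coupling. From a state of probability zero or outside [X] the kernel
    samples from [x'], since [valid_ralg] asks for a probability vector after every history. *)
Lemma coupling_kernel X x x' J : dist X x -> dist X x' -> coupling X x x' J ->
  exists k : nat -> nat -> R,
    (forall a b, 0 <= k a b) /\ (forall a, lsum X (k a) = 1) /\
    forall a b, In a X -> In b X -> x a * k a b = J a b.
Proof.
  intros Hx Hx' (HJ & Hr & _).
  exists (fun a b => if in_dec Nat.eq_dec b X then
    if in_dec Nat.eq_dec a X then if Rlt_dec 0 (x a) then J a b / x a else x' b else x' b
    else 0).
  split; [|split].
  - intros a b. destruct (in_dec Nat.eq_dec b X); [|apply Rle_refl].
    destruct (in_dec Nat.eq_dec a X); [|now apply (proj1 Hx')].
    destruct (Rlt_dec 0 (x a)); [|now apply (proj1 Hx')].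
    apply Rdiv_nonneg; auto.
  - intros a.
    rewrite (lsum_ext X _ (fun b =>
      if in_dec Nat.eq_dec a X then if Rlt_dec 0 (x a) then J a b / x a else x' b else x' b))
      by (intros b Hb; destruct (in_dec Nat.eq_dec b X); [reflexivity|contradiction]).
    destruct (in_dec Nat.eq_dec a X); [|apply Hx'].
    destruct (Rlt_dec 0 (x a)); [|apply Hx'].
    unfold Rdiv. rewrite lsum_scal_r, Hr by assumption. field. lra.
  - intros a b Ha Hb. destruct (in_dec Nat.eq_dec b X); [|contradiction].
    destruct (in_dec Nat.eq_dec a X); [|contradiction].
    destruct (Rlt_dec 0 (x a)) as [Hp|Hp]; [field; lra|].
    assert (E : x a = 0) by (generalize (proj1 Hx a Ha); lra).
    assert (J a b <= lsum X (J a)) by (apply lsum_term_le; [intros; now apply HJ|assumption]).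
    rewrite Hr, E in H by assumption. generalize (HJ a b Ha Hb). rewrite E. lra.
Qed.

Section Algorithm.

Variables (n : nat) (d D : nat -> nat -> R) (Del alpha : R).
Variables (x Phi : list (nat -> R) -> nat -> R).
Let X := seq 0 n.
Hypothesis n_pos : (1 <= n)%nat.
Hypothesis D_nonneg : forall a b, In a X -> In b X -> 0 <= D a b.
Hypothesis d_D : forall a b, In a X -> In b X -> D a b <= d a b <= 4 * D a b.
Hypothesis amort : amortized D X Del x Phi.
Hypothesis alpha_ge : 384 * ratio (size X) <= alpha.

Let ratio_X : 4 <= ratio (size X).
Proof. apply ratio_ge4, (size_ge1 X 0%nat), in_seq. lia. Qed.

Lemma alpha_cost v : 0 <= v -> 4 * (ratio (size X) * v) <= alpha * v.
Proof.
  intros Hv. assert (H := ratio_X).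
  assert (384 * ratio (size X) * v <= alpha * v) by (apply Rmult_le_compat_r; lra).
  assert (0 <= ratio (size X) * v) by (apply Rmult_le_pos; lra). lra.
Qed.

(** Pays for a move of the offline player: 384 is the Lipschitz constant 96 times the distortion
    4. *)
Lemma Phi_move h z z' : In z X -> In z' X -> 4 * Phi h z' <= 4 * Phi h z + alpha * d z z'.
Proof.
  intros Hz Hz'. destruct amort as (_ & _ & HL & _). specialize (HL h z z' Hz Hz').
  assert (H0 := D_nonneg z z' Hz Hz'). assert (Hd := d_D z z' Hz Hz'). assert (H4 := ratio_X).
  assert (384 * ratio (size X) * D z z' <= 384 * ratio (size X) * d z z')
    by (apply Rmult_le_compat_l; lra).
  assert (384 * ratio (size X) * d z z' <= alpha * d z z') by (apply Rmult_le_compat_r; lra).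
  lra.
Qed.

(** The guarantee is multiplied by 4 because movement bounded in [D] is paid in [d]. If [c] has a
    negative value, the kernel merely resamples from [x h]. *)
Lemma kernels_exist : exists k : list (nat -> R) * (nat -> R) -> nat -> nat -> R, forall q,
  (forall a b, 0 <= k q a b) /\ (forall a, lsum X (k q a) = 1) /\
  let h := fst q in let c := snd q in
  ((forall z, In z X -> 0 <= c z) ->
   (forall b, In b X -> lsum X (fun a => x h a * k q a b) = x (c :: h) b) /\
   forall z, In z X ->
     lsum X (fun a => x h a * lsum X (fun b => k q a b * (c b + d a b)))
     + 4 * Phi (c :: h) z <= alpha * c z + 4 * Phi h z).
Proof.
  apply functional_choice with (R := fun q k =>
    (forall a b, 0 <= k a b) /\ (forall a, lsum X (k a) = 1) /\
    let h := fst q in let c := snd q in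
    ((forall z, In z X -> 0 <= c z) ->
     (forall b, In b X -> lsum X (fun a => x h a * k a b) = x (c :: h) b) /\
     forall z, In z X ->
       lsum X (fun a => x h a * lsum X (fun b => k a b * (c b + d a b)))
       + 4 * Phi (c :: h) z <= alpha * c z + 4 * Phi h z)).
  intros [h c]. simpl. destruct amort as (Hx & _ & _ & Hstep).
  destruct (classic (forall z, In z X -> 0 <= c z)) as [Hc|Hn].
  - destruct (Hstep h c Hc) as [J [HJ HF]].
    destruct (coupling_kernel X (x h) (x (c :: h)) J) as (k & Hk0 & Hk1 & HkJ); auto.
    exists k. split; [assumption|]. split; [assumption|]. intros _. split.
    + intros b Hb. rewrite (lsum_ext X _ (fun a => J a b)) by (intros; now apply HkJ).
      now apply HJ.
    + intros z Hz. specialize (HF z Hz).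
      set (serv := lsum X (fun i => c i * x (c :: h) i)) in *.
      assert (Hs : 0 <= serv).
      { apply lsum_nonneg. intros i Hi. apply Rmult_le_pos; [auto|]. now apply (Hx (c :: h)). }
      assert (E : lsum X (fun a => x h a * lsum X (fun b => k a b * (c b + d a b)))
                  = serv + coupling_cost X d J).
      { unfold serv.
        rewrite (lsum_ext X (fun i => c i * x (c :: h) i) (fun b => lsum X (fun a => c b * J a b))).
        2:{ intros b Hb. rewrite lsum_scal. f_equal. symmetry. now apply HJ. }
        rewrite lsum_swap. unfold coupling_cost. rewrite <- lsum_plus. apply lsum_ext.
        intros a Ha. rewrite <- lsum_scal, <- lsum_plus. apply lsum_ext. intros b Hb.
        rewrite <- (HkJ a b Ha Hb). ring. }
      assert (HC : coupling_cost X d J <= 4 * coupling_cost X D J).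
      { unfold coupling_cost. rewrite <- lsum_scal. apply lsum_le. intros a Ha.
        rewrite <- lsum_scal. apply lsum_le. intros b Hb.
        generalize (d_D a b Ha Hb) (proj1 HJ a b Ha Hb). intros; nra. }
      assert (Ha := alpha_cost (c z) (Hc z Hz)). rewrite E. lra.
  - exists (fun _ b => if in_dec Nat.eq_dec b X then x h b else 0).
    split; [|split; [|intros; contradiction]].
    + intros _ b. destruct (in_dec Nat.eq_dec b X); [now apply (Hx h)|apply Rle_refl].
    + intros _. rewrite <- (proj2 (Hx h)). apply lsum_ext. intros b Hb.
      destruct (in_dec Nat.eq_dec b X); [reflexivity|contradiction].
Qed.

Variable k : list (nat -> R) * (nat -> R) -> nat -> nat -> R.
Hypothesis k_spec : forall q,
  (forall a b, 0 <= k q a b) /\ (forall a, lsum X (k q a) = 1) /\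
  let h := fst q in let c := snd q in
  ((forall z, In z X -> 0 <= c z) ->
   (forall b, In b X -> lsum X (fun a => x h a * k q a b) = x (c :: h) b) /\
   forall z, In z X ->
     lsum X (fun a => x h a * lsum X (fun b => k q a b * (c b + d a b)))
     + 4 * Phi (c :: h) z <= alpha * c z + 4 * Phi h z).

(* At the first step the state is resampled independently of [rho_0], which costs at most a constant. *)
Definition kernel_alg : ralg := fun cs hs b =>
  match rev cs with
  | [] => if Nat.eqb 0 b then 1 else 0
  | c :: [] => if in_dec Nat.eq_dec b X then x [c] b else 0
  | c :: h => k (h, c) (last hs 0%nat) b
  end.

Lemma kernel_alg_valid : valid_ralg n kernel_alg.
Proof.
  destruct amort as (Hx & _). split; intros cs hs; unfold kernel_alg.
  - intros b. destruct (rev cs) as [|c [|c' h]].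
    + destruct (Nat.eqb 0 b); lra.
    + destruct (in_dec Nat.eq_dec b X); [now apply (Hx [c])|apply Rle_refl].
    + apply k_spec.
  - change (sumX n) with (lsum X). destruct (rev cs) as [|c [|c' h]].
    + apply (lsum_indicator X 0%nat (fun _ => 1)); [apply seq_NoDup|apply in_seq; lia].
    + rewrite <- (proj2 (Hx [c])). apply lsum_ext. intros b Hb.
      destruct (in_dec Nat.eq_dec b X); [reflexivity|contradiction].
    + apply k_spec.
Qed.

Lemma kernel_alg_later past c hs b : past <> [] ->
  kernel_alg (past ++ [c]) hs b = k (rev past, c) (last hs 0%nat) b.
Proof.
  intros Hp. unfold kernel_alg. rewrite rev_unit. destruct (rev past) as [|c' h] eqn:E; [|reflexivity].
  apply (f_equal (@rev _)) in E. rewrite rev_involutive in E. contradiction.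
Qed.

(** After the first step [kernel_alg] reads only the last state of the history, so the cost to come
    can be averaged over the law of the current state. *)
Lemma cost_depends_on_last cs : forall past hs a, past <> [] -> last hs 0%nat = a ->
  exp_cost_aux n d kernel_alg past hs a cs = exp_cost_aux n d kernel_alg past [a] a cs.
Proof.
  induction cs as [|c cs IH]; intros past hs a Hp Ha; [reflexivity|]. simpl.
  assert (Hp' : past ++ [c] <> []) by (destruct past; discriminate).
  apply lsum_ext. intros b _. rewrite !kernel_alg_later by assumption. rewrite Ha. simpl last.
  rewrite (IH _ (hs ++ [b]) b Hp' (last_last hs b 0%nat)).
  now rewrite (IH _ [a; b] b Hp' eq_refl).
Qed.

(** The state after [past] has law [x (rev past)]. An optimal offline move to [y] is paid by
    [Phi_move], and the guarantee of the kernel is then applied at [y]. *)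
Lemma expected_cost_le cs : nonneg_costs n cs -> forall past z, past <> [] -> In z X ->
  lsum X (fun a => x (rev past) a * exp_cost_aux n d kernel_alg past [a] a cs)
  <= alpha * opt_cost n d z cs + 4 * Phi (rev past) z.
Proof.
  induction cs as [|c cs IH]; intros Hcs past z Hp Hz.
  - simpl. rewrite (lsum_eq0 X) by (intros; ring). destruct amort as (_ & H & _).
    generalize (H (rev past) z Hz). lra.
  - set (h := rev past). set (past' := past ++ [c]).
    assert (Hp' : past' <> []) by (unfold past'; destruct past; discriminate).
    assert (Eh : rev past' = c :: h) by apply rev_unit.
    assert (Hcs' : nonneg_costs n cs) by (intros c' Hc'; apply Hcs; now right).
    assert (Hc : forall y, In y X -> 0 <= c y).
    { intros y Hy. apply (Hcs c (or_introl eq_refl)). apply in_seq in Hy. lia. }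
    set (V := fun b => exp_cost_aux n d kernel_alg past' [b] b cs).
    destruct (k_spec (h, c)) as (_ & _ & Hk). simpl in Hk. destruct (Hk Hc) as [Hmarg Hcost].
    assert (E : lsum X (fun a => x h a * exp_cost_aux n d kernel_alg past [a] a (c :: cs)) =
      lsum X (fun a => x h a * lsum X (fun b => k (h, c) a b * (c b + d a b)))
      + lsum X (fun b => x (c :: h) b * V b)).
    { rewrite (lsum_ext X (fun b => x (c :: h) b * V b)
        (fun b => lsum X (fun a => x h a * k (h, c) a b * V b))).
      2:{ intros b Hb. now rewrite lsum_scal_r, Hmarg. }
      rewrite lsum_swap, <- lsum_plus. apply lsum_ext. intros a Ha.
      simpl exp_cost_aux. change (sumX n) with (lsum X).
      rewrite <- !lsum_scal, <- lsum_plus. apply lsum_ext. intros b Hb.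
      rewrite kernel_alg_later by assumption. fold past' h.
      rewrite (cost_depends_on_last cs past' [a; b] b Hp' eq_refl). fold (V b). simpl last. ring. }
    rewrite E. simpl opt_cost.
    destruct (minX_attained n (fun y => c y + d z y + opt_cost n d y cs) n_pos) as [y [Hy Ey]].
    rewrite Ey. specialize (IH Hcs' past' y Hp' Hy). rewrite Eh in IH.
    specialize (Hcost y Hy). assert (HP := Phi_move h z y Hz Hy).
    unfold V. lra.
Qed.

Lemma kernel_alg_competitive : competitive n d kernel_alg alpha.
Proof.
  intros rho Hrho. assert (HX : In rho X) by (apply in_seq; lia).
  assert (Hd0 : forall b, In b X -> 0 <= d rho b).
  { intros b Hb. generalize (D_nonneg rho b HX Hb) (d_D rho b HX Hb). lra. }
  assert (Hdn := lsum_nonneg X (d rho) Hd0).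
  assert (Ham := amort). destruct Ham as (Hx & HPhi & _ & Hstep).
  (* The initial potential, plus a bound on the resampling move of the first step. *)
  exists (4 * Phi [] rho + lsum X (d rho)). intros [|c cs] Hcs.
  { simpl. generalize (HPhi [] rho HX). unfold exp_cost. simpl. lra. }
  assert (Hcs' : nonneg_costs n cs) by (intros c' Hc'; apply Hcs; now right).
  assert (Hc : forall y, In y X -> 0 <= c y).
  { intros y Hy. apply (Hcs c (or_introl eq_refl)). apply in_seq in Hy. lia. }
  assert (Hp : [c] <> []) by discriminate.
  set (V := fun b => exp_cost_aux n d kernel_alg [c] [b] b cs).
  assert (E : exp_cost n d kernel_alg rho (c :: cs) =
    lsum X (fun b => c b * x [c] b) + lsum X (fun b => x [c] b * d rho b)
    + lsum X (fun b => x [c] b * V b)).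
  { unfold exp_cost. simpl. change (sumX n) with (lsum X). rewrite <- !lsum_plus.
    apply lsum_ext. intros b Hb. unfold kernel_alg at 1. simpl rev. cbv iota.
    destruct (in_dec Nat.eq_dec b X); [|contradiction].
    rewrite (cost_depends_on_last cs [c] [rho; b] b Hp eq_refl). fold (V b). ring. }
  assert (Hm : lsum X (fun b => x [c] b * d rho b) <= lsum X (d rho)).
  { apply lsum_le. intros b Hb. generalize (Hd0 b Hb) (dist_le1 X (x [c]) b (Hx [c]) Hb). intros; nra. }
  rewrite E. simpl opt_cost.
  destruct (minX_attained n (fun y => c y + d rho y + opt_cost n d y cs) n_pos) as [y [Hy Ey]].
  rewrite Ey. assert (HV := expected_cost_le cs Hcs' [c] y Hp Hy). simpl rev in HV. fold V in HV.
  destruct (Hstep [] c Hc) as [J [HJ HF]]. specialize (HF y Hy).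
  assert (HJ0 := coupling_cost_nonneg X D _ _ J D_nonneg HJ).
  assert (Hs : 0 <= lsum X (fun i => c i * x [c] i)).
  { apply lsum_nonneg. intros i Hi. apply Rmult_le_pos; [auto|]. now apply (Hx [c]). }
  assert (HP := Phi_move [] rho y HX Hy). assert (Ha := alpha_cost (c y) (Hc y Hy)).
  unfold V. lra.
Qed.

End Algorithm.

Theorem theorem3 :
  forall tau : R, 1 < tau ->
  exists K : R,
    forall t : tree, is_HST tau t -> (2 <= npoints t)%nat ->
      exists A : ralg,
        valid_ralg (npoints t) A /\
        competitive (npoints t) (tree_dist t) A (K * ln (INR (npoints t))).
Proof.
  (* [384 * (4 + 4 * ln n)] is at most [4608 * ln n] because [ln n >= 1 / 2]. *)
  intros tau Htau. exists 4608. intros t Ht Hn.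
  destruct (tree_ultrametric tau t Htau Ht) as [Dp [HU HD]].
  set (n := npoints t) in *. set (X := seq 0 n).
  set (D := fun i j => Dp (nth i (leaves t) []) (nth j (leaves t) [])).
  assert (Hin : forall i, In i X -> In (nth i (leaves t) []) (leaves t)).
  { intros i Hi. apply nth_In. apply in_seq in Hi. unfold n, npoints in Hi. lia. }
  assert (HUX : ultrametric_on X D).
  { destruct HU as (H1 & H2 & H3 & H4). unfold D. repeat split; intros; auto.
    apply H2; auto. intros E. apply H5.
    assert (Hj : forall i, In i X -> (i < length (leaves t))%nat).
    { intros i Hi. apply in_seq in Hi. unfold n, npoints in Hi. lia. }
    apply (proj1 (NoDup_nth (leaves t) []) (NoDup_leaves t)); auto. }
  assert (HX : X <> []) by (unfold X; destruct n; [lia|discriminate]).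
  destruct (solvable_ultrametric D X HUX (seq_NoDup n 0) HX) as (Del & x & Phi & Ham).
  assert (Hsize : size X = INR n) by (unfold size, X; now rewrite length_seq).
  assert (Hln : 1 / 2 <= ln (INR n)).
  { apply Rle_trans with (ln 2); [apply ln2_bounds|]. apply ln_mono; [lra|].
    apply (le_INR 2). exact Hn. }
  assert (Hal : 384 * ratio (size X) <= 4608 * ln (INR n))
    by (rewrite Hsize; unfold ratio; lra).
  assert (Hn1 : (1 <= n)%nat) by lia.
  assert (HD0 : forall a b, In a X -> In b X -> 0 <= D a b)
    by (intros; now apply (ultrametric_nonneg X)).
  assert (HdD : forall a b, In a X -> In b X -> D a b <= tree_dist t a b <= 4 * D a b)
    by (intros; apply HD; auto).
  destruct (kernels_exist n (tree_dist t) D Del _ x Phi Hn1 HdD Ham Hal) as [k Hk].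
  exists (kernel_alg n x k). split.
  - exact (kernel_alg_valid n _ D Del _ x Phi Hn1 Ham k Hk).
  - exact (kernel_alg_competitive n _ D Del _ x Phi Hn1 HD0 HdD Ham Hal k Hk).
Qed.
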